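(* Suppose $\ell=1$ (so $R=F_q$ and $A=F_q[y]$ with $y^2=0$). Then: (a) $Top^+=\bigoplus_{s\in S}Top^+(s)$ and $Top^-=\bigoplus_{s\in S}Top^-(s)$. (b) For $s\in S$, $Top^+(s)$ and $Top^-(s)$ are irreducible $U$-modules with characters $\mathrm{ind}_{B(s)}^U\beta_s^+$ and $\mathrm{ind}_{B(s)}^U\beta_s^-$, respectively. (c) The Weil module $X$ is multiplicity free and has $2K+1$ irreducible constituents, namely the trivial $U$-module and the $K$ constituents given in (a) for each of $Top^+$ and $Top^-$. Here $K=q$ if $m>2$, or $m=2$ and $h$ is of type $\{1,-1\}$; $K=q-1$ if $m=2$ and $h$ is of type $\{1,-\delta\}$; and $K=(q-1)/2$ if $m=1$.
   Context: Setting. $F_q$ is a finite field of odd characteristic, $A=F_q[y]=F_q\oplus F_qy$ with $y^2=0$ and involution $(r+sy)^*=r-sy$ ($r,s\in F_q$). $V$ is a free $A$-module of finite rank $m\ge 1$ and $h:V\times V\to A$ is a non-degenerate hermitian form: $h$ is bi-additive, $A$-linear in the second variable, $h(v,u)=h(u,v)^*$, and $v\mapsto h(v,-)$ is a bijection $V\to\mathrm{Hom}_A(V,A)$. $U=\{g\in\mathrm{GL}_A(V): h(gu,gv)=h(u,v)\ \forall u,v\in V\}$. Fix a non-trivial linear character $\lambda:F_q^+\to\mathbf C^\times$ and let $\mu:A^+\to\mathbf C^\times$, $\mu(r+sy)=\lambda(2s)$. Let $T$ be a transversal for $yV$ in $V$ which is symmetric ($v\in T$ iff $-v\in T$). The Weil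 module $X$ is the complex $U$-module with basis $\{e_v:v\in T\}$ and action $ge_v=\mu(h(gv,v'))e_{v'}$ for $g\in U$, $v,v'\in T$, $gv\equiv v'\bmod yV$. $Top$ is the submodule spanned by the $e_v$ with $0\ne v\in T$ (equivalently $v\in T\setminus yV$), and $Top^{\pm}$ are the $\pm1$-eigenspaces on $Top$ of the central element $\iota\in U$, $v\mapsto -v$. Let $S\subseteq T$ be a set of representatives for the equivalence relation on $V\setminus yV$ given by: $v\sim w$ if $gv\equiv w\bmod yV$ for some $g\in U$ (equivalently $h(v,v)=h(w,w)$). For $s\in S$, $Top^{\pm}(s)$ is the $U$-submodule of $Top^{\pm}$ generated by $e_s\pm e_{-s}$. For $s\in S$: $C(s)=\{g\in U: gs\equiv s\bmod yV\}$; $\beta_s:C(s)\to\mathbf C^\times$ is the linear character $g\mapsto\mu(h(gs,s))$; $B(s)=C(s)N$ where $N=\{z\in A^\times:zz^*=1\}$ acts by scalars on $V$; one has $B(s)=C(s)\times\{1,\iota\}$, and $\beta_s^{\pm}$ is the extension of $\beta_s$ to $B(s)$ with $\iota\mapsto\pm1$. $\delta\in F_q^\times$ is a fixed non-square. $h$ is of type $\{r_1,\dots,r_m\}$ ($r_i\in F_q^\times$) if $V$ has a basis relative to which $h$ has matrix $\mathrm{diag}(r_1,\dots,r_m)$. *)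

(* Defs.v *)
From HB Require Import structures.
From mathcomp Require Import all_boot all_order all_fingroup all_algebra.
From mathcomp Require Import all_solvable all_field all_character.

Set Implicit Arguments.
Unset Strict Implicit.
Unset Printing Implicit Defensive.

Import GRing.Theory.
Local Open Scope ring_scope.

Notation dualnum F := {poly %/ ('X^2 : {poly F})}.

Section DualNumbers.

Variable F : finFieldType.
Implicit Types (r : F) (a b z : dualnum F).

Local Notation y := ('qX : dualnum F).

(* r + s y is encoded by the polynomial with coefficients r and s *)
Definition dconj a : dualnum F := (a`_0)%:A - a`_1 *: y.

Lemma coef_qX i : y`_i = (i == 1%N)%:R.
Proof. by rewrite qpolyXE ?size_polyXn ?monicXn // coefX. Qed.

Lemma coef_dual1 i : (1 : dualnum F)`_i = (i == 0%N)%:R.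
Proof. by rewrite -[LHS]/((1%:P : {poly F})`_i) coefC; case: i. Qed.

Lemma coef_dualZ r a i : (r *: a)`_i = r * a`_i.
Proof. by rewrite poly_of_qpolyZ coefZ. Qed.

Lemma coef_dualD a b i : (a + b)`_i = a`_i + b`_i.
Proof. by rewrite poly_of_qpolyD coefD. Qed.

Lemma coef_dualN a i : (- a)`_i = - a`_i.
Proof. by rewrite -scaleN1r coef_dualZ mulN1r. Qed.

Lemma dualP a b : a`_0 = b`_0 -> a`_1 = b`_1 -> a = b.
Proof.
move=> e0 e1; apply/npolyP=> -[|[|i]] //.
have bnd (c : dualnum F) : c`_i.+2 = 0 :> F.
  by apply: nth_default; rewrite -ltnS (leq_trans (size_mk_monic c)) //
     mk_monic_Xn size_polyXn.
by rewrite !bnd.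
Qed.

Lemma dualE a : a = (a`_0)%:A + a`_1 *: y.
Proof.
by apply: dualP; rewrite coef_dualD !coef_dualZ coef_dual1 coef_qX /=
   ?(mulr0, mulr1, addr0, add0r).
Qed.

Lemma qX_sqr : y * y = 0.
Proof.
rewrite -[y]/(in_qpoly 'X^2 'X) -in_qpolyM -expr2; apply/val_inj => /=.
by rewrite mk_monic_Xn Pdiv.RingMonic.rmodpp ?monicXn.
Qed.

Lemma qX_mul a : y * a = a`_0 *: y.
Proof.
by rewrite {1}[a]dualE mulrDr -!scalerAr qX_sqr mulr1 scaler0 addr0.
Qed.

Lemma dconj0 a : (dconj a)`_0 = a`_0.
Proof.
by rewrite coef_dualD coef_dualN !coef_dualZ coef_dual1 coef_qX /=
   mulr1 mulr0 subr0.
Qed.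

Lemma dconj1 a : (dconj a)`_1 = - a`_1.
Proof.
by rewrite coef_dualD coef_dualN !coef_dualZ coef_dual1 coef_qX /=
   mulr1 mulr0 add0r.
Qed.

Lemma dualM a b : a * b = a`_0 *: b + (a`_1 * b`_0) *: y.
Proof.
by rewrite {1}[a]dualE mulrDl -!scalerAl mul1r qX_mul scalerA.
Qed.

Lemma dconjM a b : dconj (a * b) = dconj a * dconj b.
Proof.
have M0 (c d : dualnum F) : (c * d)`_0 = c`_0 * d`_0 :> F.
  by rewrite dualM coef_dualD !coef_dualZ coef_qX mulr0 addr0.
have M1 (c d : dualnum F) : (c * d)`_1 = c`_0 * d`_1 + c`_1 * d`_0 :> F.
  by rewrite dualM coef_dualD !coef_dualZ coef_qX mulr1.
apply: dualP; first by rewrite M0 !dconj0 M0.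
by rewrite M1 !dconj1 !dconj0 M1 opprD mulrN mulNr.
Qed.

Lemma dconjK a : dconj (dconj a) = a.
Proof. by apply: dualP; rewrite ?dconj0 ?dconj1 ?dconj0 ?dconj1 ?opprK. Qed.

End DualNumbers.

Lemma lin_char_of_morph (gT : finGroupType) (G : {group gT}) (phi : 'CF(G)) :
    phi 1%g = 1 -> {in G &, {morph phi : x y / (x * y)%g >-> x * y}} ->
  phi \is a linear_char.
Proof.
move=> phi1 phiM.
have rP : mx_repr G (fun x => (phi x)%:M : 'M[algC]_1).
  by split=> [|x y Gx Gy]; rewrite ?phi1 // phiM // scalar_mxM.
rewrite qualifE /= phi1 eqxx andbT.
have -> : phi = cfRepr (MxRepresentation rP).
  by apply/cfun_inP=> x Gx; rewrite cfunE Gx /= mxtrace_scalar.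
exact: cfRepr_char.
Qed.

Section HermitianSpaces.

Variables (F : finFieldType) (V : finLmodType (dualnum F)).

Record hermitian_form := HermitianForm {
  form_val :> V -> V -> dualnum F;
  _ : forall u u' v, form_val (u + u') v = form_val u v + form_val u' v;
  _ : forall u, scalar (form_val u);
  _ : forall u v, form_val v u = dconj (form_val u v)
}.

Definition nondegenerate_form (h : hermitian_form) :=
  forall f : {scalar V}, exists! v, f =1 h v.

Definition is_basis n (b : 'I_n -> V) :=
  bijective (fun a : 'rV[dualnum F]_n => \sum_i a 0 i *: b i).

Definition free_of_rank n := exists b : 'I_n -> V, is_basis b.

Definition of_type (h : hermitian_form) (r : seq F) :=
  exists2 b : 'I_(size r) -> V, is_basis b &
    \matrix_(i, j) h (b i) (b j) = diag_mx (\row_i (r`_i)%:A).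

Definition yV : {set V} := [set ('qX : dualnum F) *: v | v : V].

Definition symmetric_transversal (T : {set V}) :=
  (forall v, exists! t, t \in T /\ v - t \in yV) /\
  (forall v, (v \in T) = (- v \in T)).

Section Form.

Variable h : hermitian_form.

(* MathComp composes permutations from left to right: (g * k) v = k (g v). *)
Definition unitary_set : {set {perm V}} :=
  [set g : {perm V} | [forall a : dualnum F, forall u : V, forall v : V,
                         g (a *: u + v) == a *: g u + g v]
                    && [forall u : V, forall v : V, h (g u) (g v) == h u v]].

Lemma unitaryP (g : {perm V}) :
  reflect (linear g /\ (forall u v, h (g u) (g v) = h u v))
          (g \in unitary_set).
Proof.
rewrite inE; apply: (iffP andP) => [[/forallP gL /forallP gh]|[gL gh]].
  split=> [a u v|u v]; last by have /forallP/(_ v)/eqP := gh u.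
  by have /forallP/(_ u)/forallP/(_ v)/eqP := gL a.
split; first by apply/forallP=> a; apply/forallP=> u; apply/forallP=> v; rewrite gL.
by apply/forallP=> u; apply/forallP=> v; rewrite gh.
Qed.

Lemma unitary_group_set : group_set unitary_set.
Proof.
apply/group_setP; split=> [|g k /unitaryP[gL gh] /unitaryP[kL kh]].
  by apply/unitaryP; split=> [a u v|u v]; rewrite !perm1.
by apply/unitaryP; split=> [a u v|u v]; rewrite !permM ?gL ?kL ?gh ?kh.
Qed.

Definition unitary : {group {perm V}} := Group unitary_group_set.

Definition equiv_yV (v w : V) := exists2 g, g \in unitary & g v - w \in yV.

Definition orbit_representatives (T S : {set V}) :=
  [/\ S \subset T, {in S, forall s, s \notin yV} &
      forall v, v \notin yV -> exists! s, s \in S /\ equiv_yV v s].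

Definition iotaV : {perm V} := perm (@oppr_inj V).

Definition stab_yV (s : V) : {set {perm V}} :=
  [set g in unitary | g s - s \in yV].

Definition norm1_scalars : {set {perm V}} :=
  [set g : {perm V} | [exists z : dualnum F,
     (z * dconj z == 1) && [forall v, g v == z *: v]]].


Lemma formDl u u' v : h (u + u') v = h u v + h u' v.
Proof. by case: h. Qed.

Lemma formPr u a v v' : h u (a *: v + v') = a * h u v + h u v'.
Proof. by case: h => f fD fL fC /=; rewrite fL. Qed.

Lemma formC u v : h v u = dconj (h u v).
Proof. by case: h. Qed.

Lemma formDr u v v' : h u (v + v') = h u v + h u v'.
Proof. by rewrite -[v]scale1r formPr mul1r scale1r. Qed.

Lemma form0r u : h u 0 = 0.
Proof. by apply: (addIr (h u 0)); rewrite -formDr !add0r. Qed.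

Lemma formZr u a v : h u (a *: v) = a * h u v.
Proof. by rewrite -[a *: v]addr0 formPr form0r addr0. Qed.

Lemma formNr u v : h u (- v) = - h u v.
Proof. by rewrite -scaleN1r formZr mulN1r. Qed.

Lemma formNl u v : h (- u) v = - h u v.
Proof. by apply: (addIr (h u v)); rewrite -formDl !addNr formC form0r; apply: dualP;
  rewrite (dconj0, dconj1) // coef0 oppr0. Qed.

Lemma form_diag v : (h v v)`_1 = - (h v v)`_1.
Proof. by rewrite {1}formC dconj1. Qed.

Lemma yVP v : reflect (exists w, v = 'qX *: w) (v \in yV).
Proof.
by apply: (iffP imsetP) => [[w _ ->]|[w ->]]; exists w; rewrite ?inE.
Qed.

Lemma form_yy u v : u \in yV -> v \in yV -> h u v = 0.
Proof.
move=> /yVP[a ->] /yVP[b ->]; rewrite formZr formC formZr !qX_mul.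
by rewrite dconj0 coef_dualZ coef_qX mulr0 scale0r.
Qed.

Lemma yV_add u v : u \in yV -> v \in yV -> u + v \in yV.
Proof.
by move=> /yVP[a ->] /yVP[b ->]; apply/yVP; exists (a + b); rewrite scalerDr.
Qed.

Lemma yV_scale a v : v \in yV -> a *: v \in yV.
Proof.
move=> /yVP[b ->]; apply/yVP; exists (a *: b).
by rewrite !scalerA mulrC.
Qed.

Lemma yV_opp v : v \in yV -> - v \in yV.
Proof. by rewrite -scaleN1r; apply: yV_scale. Qed.

Lemma unitaryB g u v : g \in unitary -> g (u - v) = g u - g v.
Proof.
by case/unitaryP=> gL _; rewrite addrC -scaleN1r gL scaleN1r addrC.
Qed.

Lemma unitary_yV g v : g \in unitary -> v \in yV -> g v \in yV.
Proof.
move=> Ug /yVP[w ->]; apply/yVP; exists (g w).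
have g0 : g 0 = 0 by have := unitaryB 0 0 Ug; rewrite !subrr.
case/unitaryP: Ug => gL _.
by rewrite -[_ *: w]addr0 gL g0 addr0.
Qed.

Lemma iotaE v : iotaV v = - v.
Proof. by rewrite permE. Qed.

Lemma iota_unitary : iotaV \in unitary.
Proof.
apply/unitaryP; split=> [a u v|u v]; first by rewrite !iotaE opprD scalerN.
by rewrite !iotaE formNl formNr opprK.
Qed.

Lemma iota2 : (iotaV * iotaV)%g = 1%g.
Proof. by apply/permP=> v; rewrite permM !iotaE opprK perm1. Qed.

Lemma iota_comm g : g \in unitary -> commute iotaV g.
Proof.
rewrite /commute => Ug; apply/permP=> v; rewrite !permM !iotaE.
have g0 : g 0 = 0 by have := unitaryB 0 0 Ug; rewrite !subrr.
by rewrite -sub0r unitaryB // g0 sub0r.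
Qed.

Lemma stabE s g : (g \in stab_yV s) = (g \in unitary) && (g s - s \in yV).
Proof. by rewrite in_set. Qed.

Lemma stab_group_set s : group_set (stab_yV s).
Proof.
apply/group_setP; split=> [|g k].
  rewrite stabE group1 perm1 subrr; apply/yVP; exists 0.
  by rewrite scaler0.
rewrite !stabE => /andP[Ug gs] /andP[Uk ks]; rewrite groupM //= permM.
have := yV_add (unitary_yV Uk gs) ks.
by rewrite unitaryB // addrA subrK.
Qed.
Canonical stab_group s := Group (stab_group_set s).

Lemma stab_unitary s g : g \in stab_yV s -> g \in unitary.
Proof. by rewrite stabE => /andP[]. Qed.

Lemma norm1P (g : {perm V}) :
  reflect (exists2 z : dualnum F, z * dconj z = 1 & forall v, g v = z *: v)
          (g \in norm1_scalars).
Proof.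
rewrite inE; apply: (iffP existsP) => [[z /andP[/eqP z1 /forallP zg]]|[z z1 zg]].
  by exists z => // v; apply/eqP.
by exists z; rewrite z1 eqxx; apply/forallP=> v; rewrite zg.
Qed.

Lemma norm1_unitary : norm1_scalars \subset unitary.
Proof.
apply/subsetP=> g /norm1P[z z1 gz]; apply/unitaryP; split=> [a u v|u v].
  by rewrite !gz scalerDr !scalerA mulrC.
by rewrite !gz formZr formC formZr dconjM mulrA z1 mul1r -formC.
Qed.

Lemma norm1_comm g k : g \in norm1_scalars -> k \in unitary -> commute k g.
Proof.
rewrite /commute => /norm1P[z z1 gz] Uk; apply/permP=> v; rewrite !permM !gz.
have k0 : k 0 = 0 by have := unitaryB 0 0 Uk; rewrite !subrr.
case/unitaryP: Uk => kL _.
by rewrite -[z *: v]addr0 kL k0 addr0.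
Qed.

Lemma norm1_group_set : group_set norm1_scalars.
Proof.
apply/group_setP; split=> [|g k /norm1P[z z1 gz] /norm1P[x x1 kx]].
  apply/norm1P; exists 1 => [|v]; last by rewrite perm1 scale1r.
  by rewrite mul1r; apply: dualP; rewrite ?dconj0 ?dconj1 ?coef_dual1 ?oppr0.
apply/norm1P; exists (x * z) => [|v]; last by rewrite permM kx gz scalerA.
by rewrite dconjM mulrACA x1 z1 mulr1.
Qed.
Canonical norm1_group := Group norm1_group_set.

Lemma norm1_stab s g :
  g \in norm1_scalars -> (g \in stab_yV s) || ((iotaV * g)%g \in stab_yV s).
Proof.
move=> Ng; have Ug := subsetP norm1_unitary _ Ng.
rewrite !stabE Ug groupM ?iota_unitary //= permM iotaE.
case/norm1P: Ng => z z1 gz; rewrite !gz.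
have z0 : z`_0 ^+ 2 == 1.
  have /(congr1 (fun a : dualnum F => a`_0)) := z1.
  rewrite dualM coef_dualD !coef_dualZ coef_qX mulr0 addr0 dconj0 coef_dual1.
  by move=> e0; rewrite expr2 e0.
have e v : z *: v - (z`_0)%:A *: v \in yV.
  rewrite -scalerBl [X in X - _]dualE addrC addKr -[_ *: 'qX]mulr1 -scalerAl.
  rewrite scalerAr -scalerA; apply/yVP.
  by exists ((z`_1)%:A *: v).
rewrite sqrf_eq1 in z0; case/orP: z0 => /eqP z0.
  by have := e s; rewrite z0 !scale1r => ->.
have := e (- s); rewrite z0 !scaleN1r opprK.
by move=> ->; rewrite orbT.
Qed.

(* The paper's B(s) is the product set C(s) N; see BgroupE. *)
Definition Bgroup (s : V) : {group {perm V}} :=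
  (stab_yV s <*> norm1_scalars)%G.

Lemma stab_sub s : stab_yV s \subset unitary.
Proof. by apply/subsetP=> g; apply: stab_unitary. Qed.

Lemma BgroupE s : Bgroup s = (stab_yV s * norm1_scalars)%g :> {set {perm V}}.
Proof.
rewrite /= comm_joingE //; apply/normC/cents_norm.
apply/centsP=> g Cg k Nk; exact: norm1_comm Nk (stab_unitary Cg).
Qed.

Lemma Bgroup_sub s : Bgroup s \subset unitary.
Proof. by rewrite join_subG stab_sub norm1_unitary. Qed.

Lemma Bgroup_dec s g : g \in Bgroup s ->
  (g \in stab_yV s) || ((iotaV * g)%g \in stab_yV s).
Proof.
rewrite BgroupE => /mulsgP[c n Cc Nn ->].
have Uc := stab_unitary Cc.
case/orP: (norm1_stab s Nn) => Cn; first by rewrite groupM.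
by rewrite [(iotaV * _)%g]mulgA (iota_comm Uc) -mulgA (groupM Cc Cn) orbT.
Qed.

Lemma iota_norm1 : iotaV \in norm1_scalars.
Proof.
apply/norm1P; exists (-1) => [|v]; last by rewrite iotaE scaleN1r.
apply: dualP; rewrite dualM coef_dualD !coef_dualZ !coef_dualN !(dconj0, dconj1)
  !coef_dualN coef_dual1 coef_qX /=;
  by rewrite ?coef_dual1 ?oppr0 ?mulr0 ?mul0r ?addr0 ?mulrN1 ?opprK.
Qed.

Lemma stab_sub_Bgroup s : stab_yV s \subset Bgroup s.
Proof. exact: joing_subl. Qed.

Lemma iota_Bgroup s : iotaV \in Bgroup s.
Proof. by rewrite (subsetP (joing_subr _ _)) ?iota_norm1. Qed.

Variable lam : 'CF([set: F]).
Hypothesis lam_lin : lam \is a linear_char.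

Definition mu (a : dualnum F) : algC := lam (2 * a`_1).

Lemma muD a b : mu (a + b) = mu a * mu b.
Proof.
by rewrite /mu coef_dualD mulrDr -(lin_charM lam_lin) ?inE.
Qed.

Lemma mu_diag v : mu (h v v) = 1.
Proof.
rewrite /mu mulrDl !mul1r {2}form_diag subrr.
exact: lin_char1 lam_lin.
Qed.

Lemma mu_neq0 a : mu a != 0.
Proof. by rewrite lin_char_neq0 ?inE. Qed.

(* g e_v = mu(h(g v, v')) e_v' is compatible with composition. *)
Lemma mu_mul g k u v w : g \in unitary -> k \in unitary ->
    g u - v \in yV -> k v - w \in yV ->
  mu (h ((g * k)%g u) w) = mu (h (g u) v) * mu (h (k v) w).
Proof.
move=> Ug Uk guv kvw; rewrite permM.
have -> : h (g u) v = h v v + h (g u - v) v by rewrite -formDl addrC subrK.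
have -> : h (k (g u)) w = h (k v) w + h (k (g u) - k v) w.
  by rewrite -formDl addrC subrK.
rewrite !muD mu_diag mul1r mulrC; congr (mu _ * _).
rewrite -unitaryB //; set d := g u - v.
have -> : w = k v - (k v - w) by rewrite opprB addrC subrK.
rewrite formDr formNr (form_yy (unitary_yV Uk guv) kvw) subr0.
by case/unitaryP: Uk.
Qed.

Section WeilModule.

Variable T : {set V}.
Hypothesis T_tr : symmetric_transversal T.

(* Rows and columns are indexed by T, and representations act on row vectors
   from the right; with the left-to-right composition of permutations, this is
   the left U-module of the text. *)
Definition Weil_mx (g : {perm V}) : 'M[algC]_#|T| :=
  \matrix_(i, j) (let v := enum_val i in let v' := enum_val j in
     if g v - v' \in yV then mu (h (g v) v') else 0).

Lemma Weil_mx_repr : mx_repr unitary Weil_mx.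
Proof.
case: T_tr => tr _.
have tr1 v t t' : t \in T -> t' \in T -> v - t \in yV -> v - t' \in yV -> t = t'.
  by move=> Tt Tt' vt vt'; have [t0 [_ u]] := tr v; rewrite -(u t) // -(u t').
have id_yV v : v - v \in yV by rewrite subrr; apply/yVP; exists 0; rewrite scaler0.
split=> [|g k Ug Uk].
  apply/matrixP=> i j; rewrite !mxE /= perm1.
  have [->|nij] := eqVneq i j; first by rewrite id_yV mu_diag.
  case: ifP => // /(tr1 _ _ _ (enum_valP i) (enum_valP j) (id_yV _)).
  by move/enum_val_inj/eqP; rewrite (negPf nij).
apply/matrixP=> i j; rewrite !mxE /=.
have [t [[Tt gt] _]] := tr (g (enum_val i)).
have {t Tt gt} [l gl] : exists l : 'I_#|T|, g (enum_val i) - enum_val l \in yV.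
  by exists (enum_rank_in Tt t); rewrite enum_rankK_in.
rewrite (bigD1 l) //= big1 ?addr0 => [|n nl]; last first.
  rewrite !mxE /=; case: ifP => [gn|]; last by rewrite mul0r.
  have /enum_val_inj/eqP := tr1 _ _ _ (enum_valP n) (enum_valP l) gn gl.
  by rewrite (negPf nl).
rewrite !mxE /= gl.
have -> : ((g * k)%g (enum_val i) - enum_val j \in yV)
       = (k (enum_val l) - enum_val j \in yV).
  have kgl := unitary_yV Uk gl; rewrite unitaryB // in kgl.
  rewrite permM; apply/idP/idP=> H.
    by have := yV_add H (yV_opp kgl); rewrite opprB addrC addrA subrK.
  by have := yV_add kgl H; rewrite addrA subrK.
case: ifP => [kl|]; last by rewrite mulr0.
exact: mu_mul.
Qed.

Definition Weil_repr : mx_representation algC unitary #|T| :=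
  MxRepresentation Weil_mx_repr.

(* e_v for v in T *)
Definition weil_basis (v : V) : 'rV[algC]_#|T| :=
  \row_i (enum_val i == v)%:R.

Definition Top : 'M[algC]_#|T| := (\sum_(v in T | v != 0) <<weil_basis v>>)%MS.

(* The sign is (-1) ^+ b: + for b = false, - for b = true. *)
Definition Top_sign (b : bool) : 'M[algC]_#|T| :=
  (Top :&: eigenspace (Weil_repr iotaV) ((-1) ^+ b))%MS.

Definition Top_gen (b : bool) (s : V) : 'M[algC]_#|T| :=
  cyclic_mx Weil_repr (weil_basis s + (-1) ^+ b *: weil_basis (- s)).

Definition Top_char (b : bool) (s : V) : 'CF(unitary) :=
  cfRepr (submod_repr (cyclic_mx_module Weil_repr
    (weil_basis s + (-1) ^+ b *: weil_basis (- s)))).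

End WeilModule.

Section Beta.

Variable s : V.

Lemma betaM g k : g \in stab_yV s -> k \in stab_yV s ->
  mu (h ((g * k)%g s) s) = mu (h (g s) s) * mu (h (k s) s).
Proof. by rewrite !stabE => /andP[Ug gs] /andP[Uk ks]; apply: mu_mul. Qed.

Fact beta_subproof : is_class_fun <<stab_yV s>>%g
  [ffun g => if g \in stab_yV s then mu (h (g s) s) else 0].
Proof.
rewrite genGid; apply: intro_class_fun => [g k Cg Ck|g /negPf-> //].
rewrite groupJ // Cg; apply: (mulfI (mu_neq0 (h (k s) s))).
by rewrite -betaM ?groupJ // -conjgC betaM // mulrC.
Qed.
Definition beta : 'CF(stab_yV s) := Cfun 0 beta_subproof.

Lemma betaE g : g \in stab_yV s -> beta g = mu (h (g s) s).
Proof. by move=> Cg; rewrite cfunE Cg. Qed.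

Lemma beta_lin : beta \is a linear_char.
Proof.
apply: lin_char_of_morph => [|g k Cg Ck]; last by rewrite !betaE ?groupM ?betaM.
by rewrite betaE ?group1 // perm1 mu_diag.
Qed.

Definition beta_sign_fun (b : bool) (g : {perm V}) : algC :=
  if g \in stab_yV s then beta g
  else if g \in Bgroup s then (-1) ^+ b * beta (iotaV * g)%g else 0.

Lemma beta_sign_fun_iota b c : c \in stab_yV s -> (iotaV * c)%g \notin stab_yV s ->
  beta_sign_fun b (iotaV * c)%g = (-1) ^+ b * beta c.
Proof.
move=> Cc nC; rewrite /beta_sign_fun (negPf nC) mulgA iota2 mul1g.
by rewrite groupM ?iota_Bgroup ?(subsetP (stab_sub_Bgroup s)).
Qed.

Fact beta_sign_subproof b :
  is_class_fun <<Bgroup s>>%g (finfun (beta_sign_fun b)).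
Proof.
rewrite genGid; apply: intro_class_fun => [g k Bg Bk|g nBg]; last first.
  rewrite /beta_sign_fun (negPf nBg).
  by rewrite (negPf (contraNN (subsetP (stab_sub_Bgroup s) g) nBg)).
have iotaJ x : x \in unitary -> (iotaV ^ x)%g = iotaV.
  by move=> Ux; rewrite conjgE (iota_comm Ux) mulKg.
have [c Cc kE] : exists2 c, c \in stab_yV s & forall x, x \in unitary -> (x ^ k = x ^ c)%g.
  case/orP: (Bgroup_dec Bk) => Ck; first by exists k.
  exists (iotaV * k)%g => // x Ux.
  by rewrite conjgM [X in _ = (X ^ k)%g]conjgE -(iota_comm Ux) mulKg.
have Ug := subsetP (Bgroup_sub s) _ Bg.
rewrite kE // /beta_sign_fun memJ_norm ?(subsetP (normG _)) //.
rewrite [_ \in Bgroup s]memJ_norm; last first.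
  by rewrite (subsetP (normG _)) ?(subsetP (stab_sub_Bgroup s)).
rewrite Bg.
have -> : (iotaV * g ^ c = (iotaV * g) ^ c)%g by rewrite conjMg iotaJ // (stab_unitary Cc).
by rewrite !cfunJ.
Qed.

(* The extension of beta to B(s) sending iotaV to (-1) ^+ b, for s not in yV. *)
Definition beta_sign b : 'CF(Bgroup s) := Cfun 0 (beta_sign_subproof b).

Hypotheses (charF : 2%N \notin [pchar F]) (s_notin : s \notin yV).

Lemma iota_notin_stab : iotaV \notin stab_yV s.
Proof.
rewrite stabE iota_unitary iotaE -opprD /=.
apply: contra s_notin => /yV_opp; rewrite opprK -mulr2n -scaler_nat => s2.
have F2 : (2 : F) != 0 by apply: contra charF => e; rewrite inE /= e.
have -> : s = ((2^-1 : F)%:A : dualnum F) *: ((2 : dualnum F) *: s).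
  rewrite scalerA -[2 : dualnum F]scaler_nat -scalerAl mul1r scalerA mulVf //.
  by rewrite !scale1r.
exact: yV_scale.
Qed.

Lemma beta_sign_res b : 'Res[stab_yV s] (beta_sign b) = beta.
Proof.
apply/cfun_inP=> g Cg; rewrite cfResE ?stab_sub_Bgroup // cfunE.
by rewrite /beta_sign_fun Cg.
Qed.

Lemma beta_sign_iota b : beta_sign b iotaV = (-1) ^+ b.
Proof.
rewrite cfunE -[X in beta_sign_fun _ X]mulg1 beta_sign_fun_iota ?mulg1 ?iota_notin_stab ?group1 //.
by rewrite (lin_char1 beta_lin) mulr1.
Qed.

Lemma beta_sign_lin b : beta_sign b \is a linear_char.
Proof.
have ni c : c \in stab_yV s -> (iotaV * c)%g \notin stab_yV s.
  by move=> Cc; rewrite groupMr ?iota_notin_stab.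
have Uc c := @stab_unitary s c.
have E0 c : c \in stab_yV s -> beta_sign b c = beta c.
  by move=> Cc; rewrite cfunE /beta_sign_fun Cc.
have E1 c : c \in stab_yV s -> beta_sign b (iotaV * c)%g = (-1) ^+ b * beta c.
  by move=> Cc; rewrite cfunE beta_sign_fun_iota ?ni.
have bM := lin_charM beta_lin.
have dec x : x \in Bgroup s ->
    exists2 c, c \in stab_yV s & x = c \/ x = (iotaV * c)%g.
  case/Bgroup_dec/orP=> C; first by exists x => //; left.
  by exists (iotaV * x)%g => //; right; rewrite mulgA iota2 mul1g.
apply: lin_char_of_morph; first by rewrite E0 ?group1 // (lin_char1 beta_lin).
move=> g k /dec[c Cc [->|->]] /dec[d Cd [->|->]].
- by rewrite !E0 ?groupM ?bM.
- by rewrite mulgA -(iota_comm (Uc _ Cc)) -mulgA !E1 ?E0 ?groupM ?bM // mulrCA.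
- by rewrite -mulgA !E1 ?E0 ?groupM ?bM // mulrA.
rewrite mulgA -[(iotaV * c * iotaV)%g]mulgA -(iota_comm (Uc _ Cc)) mulgA iota2 mul1g.
by rewrite !E1 ?E0 ?groupM ?bM // mulrACA -expr2 sqrr_sign mul1r.
Qed.

End Beta.

End Form.
End HermitianSpaces.

(* K, the number of irreducible constituents of each of Top^+ and Top^-. *)
Definition constituent_number (F : finFieldType) (V : finLmodType (dualnum F))
    (h : hermitian_form V) (m : nat) (delta : F) (K : nat) : Prop :=
  [\/ ((2 < m)%N \/ m = 2%N /\ of_type h [:: 1; -1]) /\ K = #|F|,
      (m = 2%N /\ of_type h [:: 1; - delta]) /\ K = #|F|.-1
    | m = 1%N /\ K = (#|F|.-1)./2].

(* Main.v *)
(* The congruence subgroup, of all g in U with g v = v modulo yV for every v,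
   acts diagonally on the basis e_v, and its transvections
   v |-> v + c y h(x, v) x act on e_v by the characters
   lambda(- 2 c h(x, v)_0 ^ 2).  These separate v from w unless w = v or w = - v,
   so e_v + e_{-v} and e_v - e_{-v} span the common eigenspaces in Top^+ and
   Top^-.  Every submodule is therefore spanned by the vectors of this kind it
   contains; U permutes them up to scalars, with the orbits described by Witt's
   theorem, which gives irreducibility and the absence of isomorphisms between
   constituents.  The character of Top^{+-}(s) is the trace of the projector
   (orbit of s) * (1 +- iota) / 2, computed by averaging over the transporters,
   and the number of orbits is the number of values of the quadratic form
   h(v, v) outside yV.

   The line spanned by e_0 is treated on the same footing, as Top^+(0). *)

From Pilot Require Import Defs.
From HB Require Import structures.
From mathcomp Require Import all_boot all_order all_fingroup all_algebra.
From mathcomp Require Import all_solvable all_field all_character ring.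
Import Pilot.Defs.

Set Implicit Arguments.
Unset Strict Implicit.
Unset Printing Implicit Defensive.

Import GRing.Theory Num.Theory.
Local Open Scope ring_scope.

(** * Squares in finite fields of odd characteristic *)

Section Squares.

Variable F : finFieldType.
Hypothesis charF : 2%N \notin [pchar F].

Lemma two_neq0 : (2 : F) != 0.
Proof. by apply: contra charF => e; rewrite inE /= e. Qed.

Lemma eq_opp0 (x : F) : (x == - x) = (x == 0).
Proof.
by rewrite -subr_eq0 opprK -mulr2n -mulr_natl mulf_eq0 (negPf two_neq0).
Qed.

Definition nonzero_squares : {set F} := [set x ^+ 2 | x in [set~ 0]].

(** Each fibre of squaring on the non-zero elements is a pair [{x, -x}], and [x != -x] because the
    characteristic is odd. *)
Lemma card_nonzero_squares : (2 * #|nonzero_squares|)%N = #|F|.-1.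
Proof.
rewrite -(cardC1 (0 : F)) -[RHS]sum1_card.
rewrite (partition_big (fun x => x ^+ 2) [in nonzero_squares]) /=; last first.
  by move=> x x0; apply: imset_f; rewrite !inE.
rewrite mulnC -sum_nat_const; apply: eq_bigr => _ /imsetP[x x0 ->].
rewrite !inE in x0.
rewrite sum1_card (@eq_card _ _ [set x; - x]) ?cards2 ?eq_opp0 ?x0 // => z.
rewrite !inE [LHS]inE /= inE eqf_sqr andb_idl // => /orP[]/eqP->//.
by rewrite oppr_eq0.
Qed.

Lemma card_F_gt0 : (0 < #|F|)%N.
Proof. by apply/card_gt0P; exists 0. Qed.

Lemma card_squares : (2 * #|[set x ^+ 2 | x : F]|)%N = #|F|.+1.
Proof.
have -> : [set x ^+ 2 | x : F] = 0 |: nonzero_squares.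
  apply/setP=> a; rewrite !inE; apply/imsetP/orP=> [[x _ ->]|].
    have [->|x0] := eqVneq x 0; first by left; rewrite expr0n.
    by right; apply: imset_f; rewrite !inE.
  case=> [/eqP->|/imsetP[x _ ->]]; last by exists x.
  by exists 0; rewrite // expr0n.
rewrite cardsU1 mulnDr card_nonzero_squares.
have -> : 0 \notin nonzero_squares.
  apply/imsetP=> -[x]; rewrite !inE => x0 /eqP.
  by rewrite eq_sym expf_eq0 (negPf x0).
by rewrite addnC addn2; move: card_F_gt0; case: #|F|.
Qed.

(** The non-zero squares and their multiples by [delta] are disjoint sets of [(q - 1) / 2] elements
    each, so together they exhaust the non-zero elements. *)
Lemma nonsquare_cosets (delta r : F) :
    (forall x, x ^+ 2 != delta) -> r != 0 ->
  exists2 t, t != 0 & r = t ^+ 2 \/ r = delta * t ^+ 2.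
Proof.
move=> nsq r0.
have d0 : delta != 0 by have := nsq 0; rewrite expr0n eq_sym.
pose B := [set delta * a | a in nonzero_squares].
have cB : #|B| = #|nonzero_squares| by apply: card_imset; apply: mulfI.
have dis : [disjoint nonzero_squares & B].
  rewrite disjoints_subset; apply/subsetP=> _ /imsetP[x _ ->]; rewrite !inE.
  apply/imsetP=> -[_ /imsetP[z z0 ->] e]; rewrite !inE in z0.
  by have /eqP[] := nsq (x / z); rewrite exprMn e exprVn mulfK // expf_neq0.
have UE : nonzero_squares :|: B = [set~ 0].
  apply/eqP; rewrite eqEcard cardsU disjoint_setI0 // cards0 subn0 cB.
  rewrite addnn -mul2n card_nonzero_squares cardsC1 leqnn andbT.
  apply/subsetP=> x; rewrite !inE => /orP[/imsetP[z z0 ->]|].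
    by rewrite !inE in z0; rewrite expf_neq0.
  case/imsetP=> _ /imsetP[z z0 ->] ->; rewrite !inE in z0.
  by rewrite mulf_neq0 ?expf_neq0.
have : r \in nonzero_squares :|: B by rewrite UE !inE.
rewrite inE => /orP[/imsetP[t]|/imsetP[_ /imsetP[t t0 ->] ->]].
  by rewrite !inE => t0 ->; exists t; [|left].
by rewrite !inE in t0; exists t; [|right].
Qed.

(** Pigeonhole: the values [r1 * x ^+ 2] and the values [a - r2 * z ^+ 2] form two sets of
    [(q + 1) / 2] elements each in a field of [q] elements, so they meet. *)
Lemma binary_form_universal (r1 r2 a : F) : r1 != 0 -> r2 != 0 ->
  exists x z, r1 * x ^+ 2 + r2 * z ^+ 2 = a.
Proof.
move=> r10 r20; pose Q := [set x ^+ 2 | x : F].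
pose A := [set r1 * x | x in Q]; pose B := [set a - r2 * x | x in Q].
have cA : #|A| = #|Q| by apply: card_imset; apply: mulfI.
have cB : #|B| = #|Q|.
  by apply: card_imset => x y /addrI/oppr_inj/(mulfI r20).
have /set0Pn[c] : A :&: B != set0.
  rewrite -card_gt0 -(ltn_add2l #|A :|: B|) addn0 cardsUI cA cB addnn -mul2n.
  by rewrite card_squares ltnS max_card.
rewrite inE => /andP[/imsetP[_ /imsetP[x _ ->] ->] /imsetP[_ /imsetP[z _ ->] e]].
by exists x, z; rewrite e subrK.
Qed.

End Squares.

(** * Hermitian spaces over dual numbers *)

Section DualCoefficients.

Variable F : finFieldType.
Implicit Types (r : F) (a b : dualnum F).
Local Notation y := ('qX : dualnum F).

Lemma coef_dualM0 a b : (a * b)`_0 = a`_0 * b`_0.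
Proof. by rewrite dualM coef_dualD !coef_dualZ coef_qX mulr0 addr0. Qed.

Lemma coef_dualM1 a b : (a * b)`_1 = a`_0 * b`_1 + a`_1 * b`_0.
Proof. by rewrite dualM coef_dualD !coef_dualZ coef_qX mulr1. Qed.

Lemma dual_coef0 a : a`_0 = 0 -> a = y * (a`_1)%:A.
Proof.
by move=> a0; rewrite {1}[a]dualE a0 scale0r add0r -scalerAr mulr1.
Qed.

Lemma coef_dualA r i : (r%:A : dualnum F)`_i = r *+ (i == 0%N).
Proof. by rewrite coef_dualZ coef_dual1 mulr_natr. Qed.

Lemma dualA_unit r : r != 0 -> (r^-1)%:A * (r%:A : dualnum F) = 1.
Proof.
by move=> r0; rewrite -scalerAl mul1r scalerA mulVf // scale1r.
Qed.

Lemma card_dualnum : #|{: dualnum F}| = (#|F| ^ 2)%N.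
Proof.
pose f (a : dualnum F) := (a`_0, a`_1).
have f_inj : injective f by move=> a b [e0 e1]; apply: dualP.
have f_sur p : exists a, f a = p.
  exists (p.1%:A + p.2 *: y); case: p => r s; rewrite /f !coef_dualD.
  by rewrite !coef_dualA !coef_dualZ !coef_qX /= mulr0 addr0 add0r mulr1.
rewrite -mulnn -card_prod -(card_codom f_inj); apply: eq_card => p.
by rewrite !inE; apply/codomP; have [a <-] := f_sur p; exists a.
Qed.

End DualCoefficients.

Section Geometry.

Variables (F : finFieldType) (V : finLmodType (dualnum F)).
Hypothesis charF : 2%N \notin [pchar F].
Variable m : nat.
Hypothesis V_free : free_of_rank V m.
Variable h : hermitian_form V.
Hypothesis h_nondeg : nondegenerate_form h.
Implicit Types (a : dualnum F) (u v w x : V).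

Local Notation y := ('qX : dualnum F).
Local Notation yV := (yV V).

(* The symmetric bilinear form over F induced by h on V / yV. *)
Definition red_form (u v : V) : F := (h u v)`_0.
Local Notation b := red_form.

Lemma formZl a u v : h (a *: u) v = dconj a * h u v.
Proof. by rewrite formC formZr dconjM -formC. Qed.

Lemma formBl u u' v : h (u - u') v = h u v - h u' v.
Proof. by rewrite formDl formNl. Qed.

Lemma formBr u v v' : h u (v - v') = h u v - h u v'.
Proof. by rewrite formDr formNr. Qed.

Lemma form0l v : h 0 v = 0.
Proof. by rewrite -(subrr v) formBl subrr. Qed.

Lemma red_formC u v : b u v = b v u.
Proof. by rewrite /b formC dconj0. Qed.

Lemma red_formDl u u' v : b (u + u') v = b u v + b u' v.
Proof. by rewrite /b formDl coef_dualD. Qed.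

Lemma red_formDr u v v' : b u (v + v') = b u v + b u v'.
Proof. by rewrite /b formDr coef_dualD. Qed.

Lemma red_formNl u v : b (- u) v = - b u v.
Proof. by rewrite /b formNl coef_dualN. Qed.

Lemma red_formNr u v : b u (- v) = - b u v.
Proof. by rewrite /b formNr coef_dualN. Qed.

Lemma red_formZl a u v : b (a *: u) v = a`_0 * b u v.
Proof. by rewrite /b formZl coef_dualM0 dconj0. Qed.

Lemma red_formZr a u v : b u (a *: v) = a`_0 * b u v.
Proof. by rewrite /b formZr coef_dualM0. Qed.

Lemma red_form_yl u v : u \in yV -> b u v = 0.
Proof. by case/yVP=> w ->; rewrite red_formZl coef_qX mul0r. Qed.

Lemma red_form_congr u u' v : u - u' \in yV -> b u v = b u' v.
Proof.
by move/(red_form_yl v)/eqP; rewrite red_formDl red_formNl subr_eq0 => /eqP.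
Qed.

Lemma red_form_congr2 v w : v - w \in yV -> b v v = b w w.
Proof.
by move=> vw; rewrite (red_form_congr _ vw) red_formC (red_form_congr _ vw).
Qed.

Lemma form_diagE v : h v v = (b v v)%:A.
Proof.
apply: dualP; rewrite !coef_dualA //.
by apply/eqP; rewrite -(eq_opp0 charF) {1}form_diag.
Qed.

Lemma unitary_red_form g u v : g \in unitary h -> b (g u) (g v) = b u v.
Proof. by case/unitaryP=> _ gh; rewrite /b gh. Qed.

(** By freeness [y] kills every coordinate of [v]; an element of [A] killed by [y] has zero constant
    coefficient and is therefore a multiple of [y]. *)
Lemma yV_of_ann v : y *: v = 0 -> v \in yV.
Proof.
case: V_free => e [f fK eK]; rewrite -[v]eK; set a := f v => av.
have a0 i : (a 0 i)`_0 = 0.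
  pose G (c : 'rV[dualnum F]_m) := \sum_i c 0 i *: e i.
  have GE : G (y *: a) = G 0.
    rewrite /G [RHS]big1; last by move=> j _; rewrite mxE scale0r.
    by rewrite -[RHS]av scaler_sumr; apply: eq_bigr => j _; rewrite mxE scalerA.
  have /rowP/(_ i) := can_inj fK GE; rewrite !mxE qX_mul.
  by move/(congr1 (fun c : dualnum F => c`_1)); rewrite coef_dualZ coef_qX mulr1 coef0.
apply/yVP; exists (\sum_i ((a 0 i)`_1)%:A *: e i); rewrite scaler_sumr.
by apply: eq_bigr => i _; rewrite scalerA -dual_coef0.
Qed.

Lemma yV_0 : 0 \in yV.
Proof. by apply/yVP; exists 0; rewrite scaler0. Qed.

Lemma yV_scale0 a v : a`_0 = 0 -> a *: v \in yV.
Proof.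
by move/dual_coef0=> ->; apply/yVP; exists ((a`_1)%:A *: v); rewrite scalerA.
Qed.

Lemma yV_scale_unit a v : a`_0 != 0 -> (a *: v \in yV) = (v \in yV).
Proof.
move=> a0; apply/idP/idP; last exact: yV_scale.
move/(yV_scale ((a`_0)^-1)%:A); rewrite scalerA => av.
have -> : v = ((a`_0)^-1)%:A * a *: v - ((a`_0)^-1%:A * a - 1) *: v.
  by rewrite -scalerBl opprB addrC subrK scale1r.
apply: yV_add => //; apply/yV_opp/yV_scale0.
by rewrite coef_dualD coef_dualN coef_dualM0 coef_dualA coef_dual1 mulVf ?subrr.
Qed.

Lemma yV_opp_eq v : (- v \in yV) = (v \in yV).
Proof. by apply/idP/idP=> /yV_opp //; rewrite opprK. Qed.

(** This is the uniqueness half of non-degeneracy, applied to the functional [h v]. *)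
Lemma form_inj u v : h u =1 h v -> u = v.
Proof.
have lin : scalar (h v) by case: (h).
pose f : {scalar V} := HB.pack (h v : V -> dualnum F)
  (GRing.isLinear.Build _ _ _ _ (h v : V -> dualnum F) lin).
have [w [_ uq]] := h_nondeg f.
move=> e; rewrite -(uq u); last by move=> x; rewrite e.
by rewrite -(uq v).
Qed.

(** If [u] pairs to zero modulo [y] with every vector, then [y *: u] is orthogonal to all of [V],
    hence zero, and freeness puts [u] in [yV]. *)
Lemma red_form_nondeg u : u \notin yV -> exists x, b x u != 0.
Proof.
move=> uy; apply/existsP; apply: contraR uy; rewrite negb_exists => /forallP bu.
apply/yV_of_ann/form_inj => x.
have := bu x; rewrite negbK red_formC => /eqP b0.
rewrite form0l formZl; apply: dualP;
  rewrite !(coef_dualM0, coef_dualM1, dconj0, dconj1, coef_qX, coef0) /=.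
  by rewrite mul0r.
by rewrite [(h u x)`_0]b0 mul0r mulr0 addr0.
Qed.

(* V is not the union of the two proper subgroups annihilated by u and v. *)
Lemma red_form_nondeg2 u v : u \notin yV -> v \notin yV ->
  exists x, b x u != 0 /\ b x v != 0.
Proof.
move=> /red_form_nondeg[x xu] /red_form_nondeg[z zv].
have [xv|xv] := eqVneq (b x v) 0; last by exists x.
have [zu|zu] := eqVneq (b z u) 0; last by exists z.
by exists (x + z); rewrite !red_formDl xv zu addr0 add0r.
Qed.

(** Non-degeneracy makes a map preserving [h] injective, so on the finite set [V] it is a
    permutation and no inverse has to be exhibited. *)
Lemma isometry_unitary (f : V -> V) : linear f ->
  (forall u v, h (f u) (f v) = h u v) -> exists2 g, g \in unitary h & g =1 f.
Proof.
move=> fL fh.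
have f_inj : injective f.
  by move=> u v e; apply: form_inj => x; rewrite -[LHS]fh -[RHS]fh e.
exists (perm f_inj); last by move=> v; rewrite permE.
apply/unitaryP; split=> [a u v|u v]; rewrite !permE; [exact: fL|exact: fh].
Qed.

(** The usual reflection formula works over [A] because [h u u] lies in [F]: the scalar [c] is
    self-conjugate and [c * h u u = 2], which cancels the error term. *)
Lemma reflection_exists u : b u u != 0 ->
  exists2 g, g \in unitary h &
    forall v, g v = v - (2 / b u u)%:A * h u v *: u.
Proof.
move=> u0; apply: isometry_unitary => [a v w|v w].
  rewrite formPr scalerBr addrACA -opprD scalerA -scalerDl; congr (_ - _ *: _).
  by rewrite mulrDr mulrCA.
set c := (2 / b u u)%:A; have cJ : dconj c = c.
  by apply: dualP; rewrite ?dconj0 ?dconj1 // coef_dualA oppr0.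
have cu : c * h u u = 2.
  by rewrite form_diagE -scalerAl mul1r scalerA divfK // scaler_nat.
rewrite !(formBl, formBr, formZl, formZr) dconjM cJ -[dconj (h u v)]formC.
transitivity (h v w - c * h v u * h u w * (2 - c * h u u)); first by ring.
by rewrite cu subrr mulr0 subr0.
Qed.

End Geometry.

(** * Transitivity of U on vectors of equal norm modulo yV, and the congruence subgroup *)

Section Transitivity.

Variables (F : finFieldType) (V : finLmodType (dualnum F)).
Hypothesis charF : 2%N \notin [pchar F].
Variable m : nat.
Hypothesis V_free : free_of_rank V m.
Variable h : hermitian_form V.
Hypothesis h_nondeg : nondegenerate_form h.
Implicit Types (a : dualnum F) (u v w x : V).

Local Notation y := ('qX : dualnum F).
Local Notation yV := (yV V).
Local Notation b := (red_form h).

Lemma equiv_yV_refl v : equiv_yV h v v.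
Proof. by exists 1%g; rewrite ?group1 // perm1 subrr yV_0. Qed.

Lemma equiv_yV_trans v u w : equiv_yV h u v -> equiv_yV h v w -> equiv_yV h u w.
Proof.
case=> g Ug gu [k Uk kv]; exists (g * k)%g; first exact: groupM.
rewrite permM; have := yV_add (unitary_yV Uk gu) kv.
by rewrite (unitaryB _ _ Uk) addrA subrK.
Qed.

Lemma equiv_yV_opp u v : equiv_yV h u (- v) -> equiv_yV h u v.
Proof.
case=> g Ug gu; exists (g * iotaV V)%g; first by rewrite groupM ?iota_unitary.
by rewrite permM iotaE -opprD yV_opp_eq -[v]opprK.
Qed.

Lemma equiv_yV_red_form v w : equiv_yV h v w -> b v v = b w w.
Proof.
by case=> g Ug /(red_form_congr2 h); rewrite (unitary_red_form _ _ Ug).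
Qed.

(** The reflection in [v - w] exchanges [v] and [w], but only modulo [yV], since the equality of
    norms gives [h (v - w) v] as half the norm of [v - w] only up to a multiple of [y]. *)
Lemma equiv_yV_reflection v w : b v v = b w w -> b (v - w) (v - w) != 0 ->
  equiv_yV h v w.
Proof.
move=> vw d0; have [g Ug gE] := reflection_exists charF h_nondeg d0.
exists g => //; rewrite gE addrAC -{1}[v - w]scale1r -scalerBl.
apply: yV_scale0; rewrite coef_dualD coef_dualN coef_dualM0 coef_dualA coef_dual1.
have -> : (h (v - w) v)`_0 = b (v - w) (v - w) / 2.
  apply: (canRL (mulfK (two_neq0 charF))); rewrite -/(b (v - w) v).
  rewrite !(red_formDl, red_formDr, red_formNl, red_formNr) -vw (red_formC h w v).
  by ring.
by rewrite mulf_div [2 * _]mulrC divff ?subrr // mulf_neq0 // two_neq0.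
Qed.

(** A single-vector form of Witt's theorem. A reflection in [v - w] or [v + w] suffices unless both
    are isotropic; then [v] is first moved by another reflection so as to be no longer orthogonal to
    [w]. *)
Lemma equiv_yV_of_red_form v w : v \notin yV -> w \notin yV -> b v v = b w w ->
  equiv_yV h v w.
Proof.
move=> vy wy vw.
have [d0|] := eqVneq (b (v - w) (v - w)) 0; last exact: equiv_yV_reflection.
have [e0|] := eqVneq (b (v + w) (v + w)) 0; last first.
  move=> e0; apply/equiv_yV_opp/equiv_yV_reflection; last by rewrite opprK.
  by rewrite red_formNl red_formNr opprK.
have two0 := two_neq0 charF.
rewrite !(red_formDl, red_formDr, red_formNl, red_formNr) in d0 e0.
(* The norms of [v + w] and [v - w] differ by [4 * b v w], and both vanish. *)
have vw0 : b v w = 0.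
  apply/eqP; rewrite -(mulrI_eq0 _ (mulfI two0)) -(mulrI_eq0 _ (mulfI two0)).
  by rewrite -[X in _ == X](subrr 0) -{1}e0 -d0 (red_formC h w v); apply/eqP; ring.
have v0 : b v v = 0.
  apply/eqP; rewrite -(mulrI_eq0 _ (mulfI two0)) -e0 -vw (red_formC h w v) vw0.
  by apply/eqP; ring.
have [u [uv uw]] := red_form_nondeg2 V_free h_nondeg vy wy.
(* If [u] is isotropic, [u + v] has norm [2 * b u v], and its pairings with [v] and [w] are those of
   [u] because [v] is isotropic and orthogonal to [w]. *)
have [x [xx xv xw]] : exists x, [/\ b x x != 0, b x v != 0 & b x w != 0].
  have [uu|uu] := eqVneq (b u u) 0; last by exists u.
  exists (u + v); rewrite !(red_formDl, red_formDr) uu v0 vw0 !addr0 add0r.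
  by rewrite (red_formC h v u) -mulr2n -mulr_natl mulf_neq0.
have [g Ug gE] := reflection_exists charF h_nondeg xx.
have gv0 : b (g v) (g v) = 0 by rewrite unitary_red_form.
have gvw : b (g v) w != 0.
  rewrite gE red_formDl red_formNl red_formZl vw0 add0r oppr_eq0.
  by rewrite coef_dualM0 coef_dualA !mulf_neq0 ?invr_eq0.
apply: (@equiv_yV_trans (g v)); first by exists g => //; rewrite subrr yV_0.
(* Both [g v] and [w] are isotropic, so the norm of [g v - w] is [-2 * b (g v) w], which is
   non-zero. *)
apply: equiv_yV_reflection; first by rewrite gv0 -vw v0.
rewrite !(red_formDl, red_formDr, red_formNl, red_formNr) gv0 -vw v0.
rewrite (red_formC h w) oppr0 oppr0 addr0 add0r -opprD oppr_eq0.
by rewrite -mulr2n -mulr_natl mulf_neq0.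
Qed.

(** With [d = c * y] one has [dconj d = - d], which cancels the two cross terms, and [d * d = 0],
    which kills the remaining term. *)
Lemma congruence_transvection_exists x (c : F) :
  exists2 g, g \in unitary h & forall v, g v = v + c%:A * y * h x v *: x.
Proof.
apply: (isometry_unitary h_nondeg) => [a v w|v w].
  rewrite formPr scalerDr addrACA scalerA -scalerDl; congr (_ + _ *: _).
  by rewrite mulrDr mulrCA.
set d := c%:A * y; have dJ : dconj d = - d.
  apply: dualP; rewrite ?dconj0 ?dconj1 coef_dualN // coef_dualM0 coef_qX.
  by rewrite mulr0 oppr0.
rewrite !(formDl, formDr, formZl, formZr) dconjM dJ -[dconj (h x v)]formC.
have dd : d * d = 0 by rewrite /d mulrACA qX_sqr mulr0.
transitivity (h v w - d * d * h x w * h v x * h x x); first by ring.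
by rewrite dd !mul0r subr0.
Qed.

Definition congruence_group : {set {perm V}} :=
  [set g in unitary h | [forall v, g v - v \in yV]].

Lemma congruenceP g :
  reflect (g \in unitary h /\ forall v, g v - v \in yV) (g \in congruence_group).
Proof.
rewrite !inE; apply: (iffP andP) => [[Ug /forallP gE]|[Ug gE]]; split=> //.
by apply/forallP.
Qed.

Lemma congruence_separates (lam : 'CF([set: F])) u v :
    lam \is a linear_char -> lam != 1 -> u - v \notin yV -> u + v \notin yV ->
  exists2 g, g \in congruence_group & mu lam (h (g u) u) != mu lam (h (g v) v).
Proof.
move=> lam_lin lam1 uv1 uv2.
have [x [x1 x2]] := red_form_nondeg2 V_free h_nondeg uv1 uv2.
have [r lamr] : exists r : F, lam r != 1.
  apply/existsP; apply: contraR lam1; rewrite negb_exists => /forallP lam1.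
  apply/eqP/cfun_inP=> r Gr; rewrite cfun1E Gr.
  by apply/eqP; rewrite -[_ == _]negbK lam1.
(* The difference of squares is the product of the pairings of [x] with [u - v] and [u + v]. *)
have x0 : b x u ^+ 2 - b x v ^+ 2 != 0.
  by rewrite subr_sqr mulf_neq0 // -?red_formNr -?red_formDr.
(* This [c] makes the arguments of [lam] at [u] and at [v] differ by exactly [r], which was chosen
   outside the kernel of [lam]. *)
pose c := - r / (2 * (b x u ^+ 2 - b x v ^+ 2)).
have [g Ug gE] := congruence_transvection_exists x c.
have muE w : mu lam (h (g w) w) = lam (- (2 * c * b x w ^+ 2)).
  rewrite gE formDl (muD lam_lin) (mu_diag h lam_lin) mul1r formZl /mu; congr (lam _).
  rewrite coef_dualM1 dconj0 dconj1 !(coef_dualM0, coef_dualM1, coef_dualA, coef_qX) /=.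
  by rewrite /red_form; ring.
exists g.
  apply/congruenceP; split=> // w; rewrite gE addrC addKr.
  by apply: yV_scale0; rewrite !coef_dualM0 coef_qX mulr0 mul0r.
rewrite !muE; apply: contra lamr => /eqP e.
have -> : r = (- (2 * c * b x u ^+ 2)) + 2 * c * b x v ^+ 2.
  transitivity (- (c * (2 * (b x u ^+ 2 - b x v ^+ 2)))); last by ring.
  by rewrite /c divfK ?opprK // mulf_neq0 // two_neq0.
have lamD (p q : F) : lam (p + q) = lam p * lam q.
  by rewrite -(lin_charM lam_lin) ?inE.
by rewrite lamD e -lamD addrC subrr; apply/eqP/(lin_char1 lam_lin).
Qed.

End Transitivity.

(** * The Weil module *)

(** An idempotent with row space [U] acts as the identity on [U], so the trace on [U] can be
    computed with ambient matrices, without a basis of the submodule. *)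
Lemma mxtrace_submod_repr (F : fieldType) (gT : finGroupType) (G : {group gT}) n
    (rG : mx_representation F G n) (U P : 'M[F]_n) (modU : mxmodule rG U) g :
    g \in G -> (U :=: P)%MS -> P *m P = P ->
  \tr (submod_repr modU g) = \tr (P *m rG g).
Proof.
move=> Gg UP PP; have PU : (P <= U)%MS by rewrite UP.
have : (val_submod (1%:M : 'M_(\rank U)) *m rG g <= P)%MS.
  have UP' : (U <= P)%MS by rewrite UP.
  by apply: submx_trans UP'; rewrite mxmodule_trans // val_submod1.
case/submxP=> D DE; transitivity (\tr (D *m P *m in_submod U P)).
  by rewrite [in_submod U P]in_submodE mulmxA -in_submodE -mulmxA PP -DE.
by rewrite -DE mxtrace_mulC mulmxA -val_submodE in_submodK.
Qed.

Section WeilModule.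

Variables (F : finFieldType) (V : finLmodType (dualnum F)).
Hypothesis charF : 2%N \notin [pchar F].
Variable m : nat.
Hypothesis V_free : free_of_rank V m.
Variable h : hermitian_form V.
Hypothesis h_nondeg : nondegenerate_form h.
Variable lam : 'CF([set: F]).
Hypotheses (lam_lin : lam \is a linear_char) (lam_neq1 : lam != 1).
Variable T : {set V}.
Hypothesis T_tr : symmetric_transversal T.

Local Notation yV := (yV V).
Local Notation b := (red_form h).
Local Notation U := (unitary h).
Local Notation rho := (Weil_repr h lam_lin T_tr).
Local Notation iota := (iotaV V).
Local Notation mu := (mu lam).
Implicit Types (u v w s : V) (i j : 'I_#|T|) (c : bool).

Lemma transversal_eq v w : v \in T -> w \in T -> v - w \in yV -> v = w.
Proof.
move=> Tv Tw vw; have [t [_ tE]] := (T_tr.1 v).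
by rewrite -(tE v) ?subrr ?yV_0 // -(tE w).
Qed.

Lemma transversalN v : (- v \in T) = (v \in T).
Proof. by rewrite -T_tr.2. Qed.

(** The representative of [v] modulo [yV] in [T]. The default 0 is never reached, as [trepP]
    shows. *)
Definition trep v : V := odflt 0 [pick t in T | v - t \in yV].

Lemma trepP v : trep v \in T /\ v - trep v \in yV.
Proof.
rewrite /trep; case: pickP => [t /andP[]//|no].
by have [t [[Tt vt] _]] := T_tr.1 v; have := no t; rewrite Tt vt.
Qed.

Lemma trep_unique v t : t \in T -> v - t \in yV -> trep v = t.
Proof.
have [Tv vt] := trepP v; move=> Tt vt'; apply: transversal_eq => //.
have := yV_add (yV_opp vt) vt'.
by rewrite opprB addrA subrK.
Qed.

Lemma transversal_rank v : v \in T -> exists i : 'I_#|T|, enum_val i = v.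
Proof. by move=> Tv; exists (enum_rank_in Tv v); rewrite enum_rankK_in. Qed.

(** By symmetry of [T], both [v] and [- v] represent the zero class, so they coincide, and 2 is
    invertible. *)
Lemma transversal_yV_eq0 v : v \in T -> v \in yV -> v = 0.
Proof.
move=> Tv vy.
have v2 : v = - v.
  by apply: transversal_eq; rewrite ?transversalN // opprK yV_add.
apply/eqP; rewrite -[v == 0]negbK; apply/negP => v0.
have : (2 : F)%:A *: v = 0.
  by rewrite scaler_nat scaler_nat mulr2n {2}v2 subrr.
move/(congr1 (fun u => ((2^-1 : F)%:A : dualnum F) *: u)).
rewrite scalerA (dualA_unit (two_neq0 charF)) scale1r scaler0 => e.
by rewrite e eqxx in v0.
Qed.

Lemma zero_transversal : 0 \in T.
Proof.
have [T0 /yV_opp] := trepP 0; rewrite sub0r opprK => y0.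
by rewrite -(transversal_yV_eq0 T0 y0).
Qed.

Lemma oppr_transversal v : v \in T -> v = - v -> v = 0.
Proof.
move=> Tv e; apply: transversal_yV_eq0 => //.
rewrite -(@yV_scale_unit _ V (2%:A)); last first.
  by rewrite coef_dualA mulr1n two_neq0.
by rewrite scaler_nat scaler_nat mulr2n {2}e subrr yV_0.
Qed.

(* On vectors of the transversal this is the relation of lying in the same
   U-orbit modulo yV, see [same_norm_equiv]. *)
Definition same_norm s v := (b v v == b s s) && ((v \in yV) == (s \in yV)).

Lemma yV_congr v w : v - w \in yV -> (v \in yV) = (w \in yV).
Proof.
move=> vw; apply/idP/idP=> [vy|wy]; last by rewrite -(subrK w v) yV_add.
by rewrite -[w](subKr v) yV_add // yV_opp.
Qed.

Lemma same_norm_congr s v w : v - w \in yV -> same_norm s v = same_norm s w.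
Proof.
by move=> vw; rewrite /same_norm (red_form_congr2 h vw) (yV_congr vw).
Qed.

Lemma unitary_yV_eq g v : g \in U -> (g v \in yV) = (v \in yV).
Proof.
move=> Ug; apply/idP/idP; last exact: (unitary_yV Ug).
by move/(unitary_yV (groupVr Ug)); rewrite permK.
Qed.

Lemma same_norm_unitary s g v : g \in U -> same_norm s (g v) = same_norm s v.
Proof. by move=> Ug; rewrite /same_norm unitary_red_form // unitary_yV_eq. Qed.

Lemma same_normN s v : same_norm s (- v) = same_norm s v.
Proof. by rewrite -iotaE same_norm_unitary ?iota_unitary. Qed.

Lemma same_norm_refl s : same_norm s s.
Proof. by rewrite /same_norm !eqxx. Qed.

Lemma same_norm_trans s t v : same_norm s t -> same_norm s v = same_norm t v.
Proof. by case/andP=> /eqP e1 /eqP e2; rewrite /same_norm e1 e2. Qed.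

Lemma same_norm_sym s v : same_norm s v = same_norm v s.
Proof. by rewrite /same_norm eq_sym [(v \in yV) == _]eq_sym. Qed.

Lemma same_norm_equiv s v : s \in T -> v \in T -> same_norm s v -> equiv_yV h s v.
Proof.
move=> Ts Tv /andP[/eqP vs /eqP vsy].
have [sy|sy] := boolP (s \in yV); last first.
  by apply: (equiv_yV_of_red_form charF V_free h_nondeg); rewrite // vsy.
rewrite sy in vsy; rewrite (transversal_yV_eq0 Ts sy) (transversal_yV_eq0 Tv vsy).
exact: equiv_yV_refl.
Qed.

Lemma equiv_same_norm s v : equiv_yV h s v -> same_norm s v.
Proof.
case=> g Ug gsv; rewrite -(same_norm_congr s gsv) same_norm_unitary //.
exact: same_norm_refl.
Qed.

(* The diagonal entry of g at e_v. *)
Definition diag_coef g v : algC := if g v - v \in yV then mu (h (g v) v) else 0.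

Lemma Weil_reprE g i j : rho g i j =
  if g (enum_val i) - enum_val j \in yV then mu (h (g (enum_val i)) (enum_val j))
  else 0.
Proof. by rewrite mxE. Qed.

Lemma Weil_repr_iotaE i j :
  rho iota i j = (enum_val j == - enum_val i)%:R.
Proof.
rewrite Weil_reprE iotaE; have [->|ne] := eqVneq (enum_val j) (- enum_val i).
  by rewrite subrr yV_0 // mu_diag.
case: ifP => // /transversal_eq e; rewrite e ?eqxx ?enum_valP // in ne.
by rewrite transversalN enum_valP.
Qed.

Lemma Weil_repr_congruence g i j : g \in congruence_group h ->
  rho g i j = diag_coef g (enum_val i) *+ (i == j).
Proof.
case/congruenceP=> Ug gE; rewrite Weil_reprE /diag_coef gE.
have [->|ne] := eqVneq i j; first by rewrite gE.
case: ifP => // gij; case/eqP: ne; apply: enum_val_inj.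
apply: transversal_eq; rewrite ?enum_valP //.
by have := yV_add (yV_opp (gE (enum_val i))) gij; rewrite opprB addrA subrK.
Qed.

Lemma Weil_repr_iotaM g : g \in U -> rho iota *m rho g = rho g *m rho iota.
Proof.
by move=> Ug; rewrite -!repr_mxM ?iota_unitary // (iota_comm Ug).
Qed.

Lemma Weil_repr_iota2 : rho iota *m rho iota = 1%:M.
Proof. by rewrite -repr_mxM ?iota_unitary // iota2 repr_mx1. Qed.

(** * Projectors attached to an orbit and a sign *)

Definition orbit_mx s : 'M[algC]_#|T| :=
  diag_mx (\row_i (same_norm s (enum_val i))%:R).

(** The projector onto the eigenspace of [iota] for the eigenvalue [(-1) ^+ c]. *)
Definition sign_mx c : 'M[algC]_#|T| := 2^-1 *: (1%:M + (-1) ^+ c *: rho iota).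

(** A product of two commuting idempotents. Its row space is the submodule generated by [e_s] plus
    or minus [e_{-s}], by [Top_genE]; inclusions, directness and traces thus reduce to matrix
    identities. *)
Definition Top_proj c s := orbit_mx s *m sign_mx c.

Lemma orbit_mxC s g : g \in U -> orbit_mx s *m rho g = rho g *m orbit_mx s.
Proof.
move=> Ug; rewrite mul_diag_mx mul_mx_diag; apply/matrixP=> i j.
rewrite [LHS]mxE [RHS]mxE [X in X * _]mxE [X in _ = _ * X]mxE Weil_reprE mulrC.
case: ifP => [gij|]; last by rewrite !mul0r.
by rewrite -(same_norm_congr s gij) same_norm_unitary.
Qed.

Lemma orbit_mxM s s' : orbit_mx s *m orbit_mx s' =
  if same_norm s s' then orbit_mx s else 0.
Proof.
rewrite mulmx_diag; case: ifP => ss'.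
  congr diag_mx; apply/rowP=> i; rewrite !mxE -(same_norm_trans _ ss') -natrM.
  by rewrite mulnb andbb.
apply/matrixP=> i j; rewrite !mxE -natrM mulnb.
case: andP => [[si s'i]|]; last by rewrite mul0rn.
by rewrite (same_norm_trans _ si) same_norm_sym s'i in ss'.
Qed.

Lemma sign_mxC c g : g \in U -> sign_mx c *m rho g = rho g *m sign_mx c.
Proof.
move=> Ug; rewrite -scalemxAl -scalemxAr mulmxDl mulmxDr mul1mx mulmx1.
by rewrite -scalemxAl -scalemxAr Weil_repr_iotaM.
Qed.

Lemma iota_sign_mx c : sign_mx c *m rho iota = (-1) ^+ c *: sign_mx c.
Proof.
rewrite /sign_mx -scalemxAl scalerA mulrC -scalerA; congr (_ *: _).
rewrite mulmxDl mul1mx -scalemxAl Weil_repr_iota2 scalerDr scalerA.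
by rewrite -expr2 sqrr_sign scale1r addrC.
Qed.

Lemma sign_mx_id m' (W : 'M[algC]_(m', _)) c :
  W *m rho iota = (-1) ^+ c *: W -> W *m sign_mx c = W.
Proof.
move=> Wi; rewrite -scalemxAr mulmxDr mulmx1 -scalemxAr Wi scalerA -expr2.
rewrite sqrr_sign scale1r -mulr2n -scaler_nat scalerA mulVf ?scale1r //.
by rewrite pnatr_eq0.
Qed.

Lemma sign_mx_eigen m' (W : 'M[algC]_(m', _)) c :
  W *m sign_mx c = W -> W *m rho iota = (-1) ^+ c *: W.
Proof. by move=> WE; rewrite -{1}WE -mulmxA iota_sign_mx -scalemxAr WE. Qed.

Lemma orbit_sign_mxC c s : orbit_mx s *m sign_mx c = sign_mx c *m orbit_mx s.
Proof.
rewrite -scalemxAl -scalemxAr mulmxDl mulmxDr mulmx1 mul1mx.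
by rewrite -scalemxAl -scalemxAr orbit_mxC ?iota_unitary.
Qed.

Lemma Top_projC c s g : g \in U -> Top_proj c s *m rho g = rho g *m Top_proj c s.
Proof. by move=> Ug; rewrite -mulmxA sign_mxC // mulmxA orbit_mxC // mulmxA. Qed.

Lemma sign_mx_idem c : sign_mx c *m sign_mx c = sign_mx c.
Proof. exact/sign_mx_id/iota_sign_mx. Qed.

Lemma Top_projM c s s' : Top_proj c s *m Top_proj c s' =
  if same_norm s s' then Top_proj c s else 0.
Proof.
rewrite /Top_proj [orbit_mx s' *m _]orbit_sign_mxC mulmxA -(mulmxA (orbit_mx s)) sign_mx_idem.
rewrite -mulmxA -orbit_sign_mxC mulmxA orbit_mxM; case: ifP => //.
by rewrite mul0mx.
Qed.

Lemma Top_proj_idem c s : Top_proj c s *m Top_proj c s = Top_proj c s.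
Proof. by rewrite Top_projM same_norm_refl. Qed.

Lemma mx_Top_projP m' (W : 'M[algC]_(m', _)) c s :
  (W <= Top_proj c s)%MS -> W *m Top_proj c s = W.
Proof. by case/submxP=> D ->; rewrite -mulmxA Top_proj_idem. Qed.

Lemma Top_proj_module c s : mxmodule rho (Top_proj c s).
Proof. by apply/mxmoduleP=> g Ug; rewrite Top_projC // submxMl. Qed.

(** * The generators and their images under U *)

Definition signed_vec c v : 'rV[algC]_#|T| :=
  weil_basis T v + (-1) ^+ c *: weil_basis T (- v).

Lemma weil_basis_enum i : weil_basis T (enum_val i) = delta_mx 0 i.
Proof.
by apply/rowP=> j; rewrite !mxE /= (inj_eq enum_val_inj).
Qed.

Lemma weil_basis_mul i m' (A : 'M[algC]_(_, m')) : weil_basis T (enum_val i) *m A = row i A.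
Proof. by rewrite weil_basis_enum rowE. Qed.

Lemma weil_basis_iota v : v \in T -> weil_basis T v *m rho iota = weil_basis T (- v).
Proof.
case/transversal_rank=> i <-; rewrite weil_basis_mul; apply/rowP=> j.
by rewrite mxE Weil_repr_iotaE mxE.
Qed.

Lemma weil_basis_act g v w : g \in U -> v \in T -> w \in T -> g v - w \in yV ->
  weil_basis T v *m rho g = mu (h (g v) w) *: weil_basis T w.
Proof.
move=> Ug /transversal_rank[i <-] /transversal_rank[j <-] gij.
rewrite weil_basis_mul; apply/rowP=> k; rewrite mxE Weil_reprE !mxE.
rewrite (inj_eq enum_val_inj); have [->|ne] := eqVneq k j.
  by rewrite gij mulr1.
rewrite mulr0; case: ifP => // gik; case/eqP: ne; apply: enum_val_inj.
apply: transversal_eq; rewrite ?enum_valP //.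
by have := yV_add (yV_opp gik) gij; rewrite opprB addrA subrK.
Qed.

Lemma weil_basis_orbit_mx s v : v \in T ->
  weil_basis T v *m orbit_mx s = (same_norm s v)%:R *: weil_basis T v.
Proof.
case/transversal_rank=> i <-; rewrite mul_mx_diag; apply/rowP=> j.
rewrite !mxE (inj_eq enum_val_inj).
by have [->|_] := eqVneq j i; rewrite ?mulr1 ?mul1r // mul0r mulr0.
Qed.

Lemma signed_vecE c v : v \in T ->
  signed_vec c v = 2 *: (weil_basis T v *m sign_mx c).
Proof.
move=> Tv; rewrite -scalemxAr scalerA divff ?pnatr_eq0 // scale1r.
by rewrite mulmxDr mulmx1 -scalemxAr weil_basis_iota.
Qed.

Lemma signed_vecN c v : signed_vec c (- v) = (-1) ^+ c *: signed_vec c v.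
Proof.
rewrite /signed_vec opprK scalerDr scalerA -expr2 sqrr_sign scale1r.
exact: addrC.
Qed.

Lemma signed_vec_act c g v w : g \in U -> v \in T -> w \in T -> g v - w \in yV ->
  signed_vec c v *m rho g = mu (h (g v) w) *: signed_vec c w.
Proof.
move=> Ug Tv Tw gvw; rewrite !signed_vecE // -scalemxAl -mulmxA sign_mxC //.
rewrite mulmxA (weil_basis_act Ug Tv Tw gvw) -scalemxAl !scalerA.
by rewrite mulrC.
Qed.

Lemma signed_vec_sign_mx c v : v \in T -> signed_vec c v *m sign_mx c = signed_vec c v.
Proof. by move=> Tv; rewrite signed_vecE // -scalemxAl -mulmxA sign_mx_idem. Qed.

Lemma signed_vec_Top_proj c s v : v \in T ->
  signed_vec c v *m Top_proj c s = (same_norm s v)%:R *: signed_vec c v.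
Proof.
move=> Tv; rewrite /Top_proj orbit_sign_mxC mulmxA signed_vec_sign_mx //.
rewrite signed_vecE // -scalemxAl -mulmxA -orbit_sign_mxC mulmxA.
by rewrite weil_basis_orbit_mx // -scalemxAl !scalerA mulrC.
Qed.

(** The generator is fixed by the projector. Conversely a row of the projector is zero or half of
    [signed_vec c v] with [v] in the orbit of [s], and transitivity makes this vector a non-zero
    multiple of an image of the generator. *)
Lemma Top_genE c s : s \in T -> (Top_gen h lam_lin T_tr c s :=: Top_proj c s)%MS.
Proof.
move=> Ts; apply/eqmxP/andP; split.
  apply: cyclic_mx_sub; first exact: Top_proj_module.
  rewrite -/(signed_vec c s); have := signed_vec_Top_proj c s Ts.
  by rewrite same_norm_refl scale1r => <-; apply: submxMl.
apply/row_subP=> i; rewrite -weil_basis_mul mulmxA weil_basis_orbit_mx ?enum_valP //.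
rewrite -scalemxAl; case: (boolP (same_norm s _)) => [si|_]; last first.
  by rewrite scale0r sub0mx.
have Ti := enum_valP i; have [g Ug gsi] := same_norm_equiv Ts Ti si.
have := signed_vec_act c Ug Ts Ti gsi; rewrite (signed_vecE _ Ti) => e.
apply: scalemx_sub.
have mu0 := mu_neq0 lam_lin (h (g s) (enum_val i)).
have two0 : (2 : algC) != 0 by rewrite pnatr_eq0.
rewrite -(eqmx_scale _ two0) -(eqmx_scale _ mu0) -e.
apply: mxmodule_trans => //; first exact: cyclic_mx_module.
exact: cyclic_mx_id.
Qed.

(** * Common eigenvectors of the congruence subgroup, irreducibility and isomorphisms *)

Lemma eigen_support (x : 'rV[algC]_#|T|) v : v \in T ->
    (forall g, g \in congruence_group h -> x *m rho g = diag_coef g v *: x) ->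
  forall i, x 0 i != 0 -> enum_val i = v \/ enum_val i = - v.
Proof.
move=> Tv xE i xi0; have Ti := enum_valP i.
have [->|ne1] := eqVneq (enum_val i) v; first by left.
have [->|ne2] := eqVneq (enum_val i) (- v); first by right.
have y1 : v - enum_val i \notin yV.
  by apply: contraNN ne1 => /(transversal_eq Tv Ti) ->.
have y2 : v + enum_val i \notin yV.
  apply: contraNN ne2; rewrite addrC -{1}[v]opprK => /transversal_eq -> //.
  by rewrite transversalN.
(* Away from [v] and [- v], some [g] of the congruence group scales [e_i] and [e_v] differently,
   which contradicts the eigenvector equation at the coordinate [i]. *)
have [g Gg] := congruence_separates charF V_free h_nondeg lam_lin lam_neq1 y1 y2.
have [Ug gE] := congruenceP _ _ Gg.
have := congr1 (fun A : 'rV_#|T| => A 0 i) (xE g Gg).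
rewrite !mxE (bigD1 i) //= big1 => [|j ji]; last first.
  by rewrite Weil_repr_congruence // (negPf ji) mulr0.
rewrite Weil_repr_congruence // eqxx addr0 mulr1n mulrC => /(mulIf xi0).
by rewrite /diag_coef !gE => -> /eqP[].
Qed.

(** The vector is fixed by [sign_mx c] and supported on [v] and [- v], and [sign_mx c] sends both
    basis vectors to multiples of [signed_vec c v]. *)
Lemma eigen_line (x : 'rV[algC]_#|T|) c v : v \in T ->
    (forall g, g \in congruence_group h -> x *m rho g = diag_coef g v *: x) ->
  x *m rho iota = (-1) ^+ c *: x -> exists a, x = a *: signed_vec c v.
Proof.
move=> Tv xE /sign_mx_id xJ; have supp := eigen_support Tv xE.
suff /sub_rVP : (x <= signed_vec c v)%MS by [].
rewrite -xJ [x in x *m _]row_sum_delta mulmx_suml summx_sub // => i _.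
rewrite -scalemxAl; have [->|/supp xi] := eqVneq (x 0 i) 0.
  by rewrite scale0r sub0mx.
apply: scalemx_sub; rewrite -weil_basis_enum.
have two0 : (2 : algC) != 0 by rewrite pnatr_eq0.
rewrite -(eqmx_scale _ two0) -signed_vecE ?enum_valP //.
by case: xi => ->; rewrite ?signed_vecN ?scalemx_sub.
Qed.

Lemma signed_vec_congruence c v g : v \in T -> g \in congruence_group h ->
  signed_vec c v *m rho g = diag_coef g v *: signed_vec c v.
Proof.
move=> Tv /congruenceP[Ug gE].
by rewrite (signed_vec_act c Ug Tv Tv (gE v)) /diag_coef gE.
Qed.

Lemma signed_vec_iota c v : v \in T ->
  signed_vec c v *m rho iota = (-1) ^+ c *: signed_vec c v.
Proof. by move=> Tv; apply/sign_mx_eigen/signed_vec_sign_mx. Qed.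

(** The second hypothesis excludes only [e_0 - e_0], the case of [v = 0] with the minus sign. *)
Lemma signed_vec_neq0 c v : v \in T -> (v == 0) ==> ~~ c -> signed_vec c v != 0.
Proof.
move=> Tv vc; have [i iv] := transversal_rank Tv; apply/eqP => /rowP/(_ i)/eqP.
rewrite !mxE iv eqxx; have [e|ne] := eqVneq v (- v); last first.
  by rewrite mulr0 addr0 oner_eq0.
move: vc; rewrite (oppr_transversal Tv e) eqxx /= => /negPf->.
by rewrite expr0 mulr1 -(natrD _ 1 1) pnatr_eq0.
Qed.

Lemma capmx0_eigen n (W W' A : 'M[algC]_n) (w w' : 'rV[algC]_n) a :
    (W :&: W' = 0)%MS -> (w <= W)%MS -> (w' <= W')%MS ->
    (w *m A <= W)%MS -> (w' *m A <= W')%MS ->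
    (w + w') *m A = a *: (w + w') ->
  w *m A = a *: w /\ w' *m A = a *: w'.
Proof.
move=> WW' Ww Ww' WA WA' e.
have d : w *m A - a *: w = a *: w' - w' *m A.
  apply/eqP; rewrite subr_eq addrAC eq_sym subr_eq addrC eq_sym -mulmxDl e.
  by rewrite scalerDr addrC.
have : (w *m A - a *: w <= W :&: W')%MS.
  by rewrite sub_capmx {2}d !addmx_sub ?eqmx_opp ?scalemx_sub.
rewrite WW' submx0 => /eqP d0; split; apply/eqP; rewrite -subr_eq0 ?d0 //.
by rewrite -opprB -d d0 oppr0.
Qed.

(* In a Maschke decomposition, both components of the generator are common
   eigenvectors of the congruence subgroup and of iota with the same eigenvalues,
   hence multiples of the generator. *)
Lemma Top_gen_simple c s : s \in T -> (s == 0) ==> ~~ c ->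
  mxsimple rho (Top_gen h lam_lin T_tr c s).
Proof.
move=> Ts sc; have f0 := signed_vec_neq0 Ts sc.
have fT : (signed_vec c s <= Top_gen h lam_lin T_tr c s)%MS := cyclic_mx_id _ _.
split; first exact: cyclic_mx_module.
  by apply: contraNneq f0 => e; rewrite e submx0 in fT.
move=> W modW WT W0; apply: cyclic_mx_sub => //; rewrite -/(signed_vec c s).
have [W' modW' WW' dW] := mx_Maschke_pchar rho (algC'G_pchar _) modW (submx1 W).
have [[x x'] /= fE] : exists x, signed_vec c s = x.1 *m W + x.2 *m W'.
  by apply/sub_addsmxP; rewrite WW' submx1.
set w := x *m W in fE; set w' := x' *m W' in fE.
have Ww : (w <= W)%MS by apply: submxMl.
have Ww' : (w' <= W')%MS by apply: submxMl.
have cap0 : (W :&: W' = 0)%MS by apply/mxdirect_addsP.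
have eig g a : g \in U -> signed_vec c s *m rho g = a *: signed_vec c s ->
    w *m rho g = a *: w /\ w' *m rho g = a *: w'.
  by move=> Ug; rewrite fE; apply: (capmx0_eigen cap0); rewrite ?mxmodule_trans.
have [wi wi'] := eig _ _ (iota_unitary h) (signed_vec_iota c Ts).
have wE g : g \in congruence_group h ->
    w *m rho g = diag_coef g s *: w /\ w' *m rho g = diag_coef g s *: w'.
  move=> Gg; have [Ug _] := congruenceP _ _ Gg.
  exact: eig Ug (signed_vec_congruence c Ts Gg).
have [a wa] := eigen_line Ts (fun g Gg => (wE g Gg).1) wi.
have [a0|a0] := eqVneq a 0; last first.
  by rewrite -(eqmx_scale _ a0) -wa.
have fw' : signed_vec c s = w' by rewrite fE wa a0 scale0r add0r.
have TW' : (Top_gen h lam_lin T_tr c s <= W')%MS.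
  by apply: cyclic_mx_sub => //; rewrite -/(signed_vec c s) fw'.
case/eqP: W0; apply/eqP; rewrite -submx0 -cap0 sub_capmx submx_refl.
exact: submx_trans TW'.
Qed.

(** An isomorphism carries the generator to a non-zero vector with the same eigenvalues. That of
    [iota] recovers the sign, and those of the congruence group confine the support to [s] and
    [- s], which recovers the orbit. *)
Lemma Top_gen_iso c c' s s' : s \in T -> s' \in T -> (s == 0) ==> ~~ c ->
    mx_iso rho (Top_gen h lam_lin T_tr c s) (Top_gen h lam_lin T_tr c' s') ->
  c = c' /\ same_norm s' s.
Proof.
move=> Ts Ts' sc [f f_unit f_hom fE].
have f0 := signed_vec_neq0 Ts sc.
have fT : (signed_vec c s <= Top_gen h lam_lin T_tr c s)%MS := cyclic_mx_id _ _.
set z := signed_vec c s *m f.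
have z0 : z != 0.
  by apply: contraNneq f0 => e; rewrite -(mulmxK f_unit (signed_vec c s)) -/z e mul0mx.
have zT : (z <= Top_proj c' s')%MS.
  by rewrite -(Top_genE c' Ts') -fE submxMr.
have zg g a : g \in U -> signed_vec c s *m rho g = a *: signed_vec c s ->
    z *m rho g = a *: z.
  move=> Ug e; have /hom_mxP/(_ g Ug) := submx_trans fT f_hom.
  by rewrite e -scalemxAl => ->.
have zi := zg _ _ (iota_unitary h) (signed_vec_iota c Ts).
have zP := mx_Top_projP zT.
have zi' : z *m rho iota = (-1) ^+ c' *: z.
  by apply: sign_mx_eigen; rewrite -{1}zP -mulmxA -[Top_proj c' s' *m _]mulmxA sign_mx_idem.
have [i zi0] : exists i, z 0 i != 0 by apply/rV0Pn.
split.
  apply/eqP; rewrite -(inj_eq (@signr_inj algC)).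
  have := congr1 (fun A : 'rV_#|T| => A 0 i) (etrans (esym zi) zi').
  by rewrite mxE [RHS]mxE => /(mulIf zi0) ->.
have zG g : g \in congruence_group h -> z *m rho g = diag_coef g s *: z.
  move=> Gg; have [Ug _] := congruenceP _ _ Gg.
  exact: zg Ug (signed_vec_congruence c Ts Gg).
have : z *m orbit_mx s' = z.
  rewrite -zP -mulmxA; congr (_ *m _).
  by rewrite /Top_proj -mulmxA -orbit_sign_mxC mulmxA orbit_mxM same_norm_refl.
move/(congr1 (fun A : 'rV_#|T| => A 0 i)); rewrite mul_mx_diag mxE [X in _ * X]mxE.
move=> zs; apply/idPn => ns; case/eqP: (zi0).
by rewrite -zs; case: (eigen_support Ts zG zi0) => ->;
  rewrite ?same_normN (negPf ns) mulr0.
Qed.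

(** * Characters of the summands as induced characters *)

Definition norm_trace s g : algC := \sum_(v in T | same_norm s v) diag_coef g v.

Lemma trace_orbit_mx s g : \tr (orbit_mx s *m rho g) = norm_trace s g.
Proof.
rewrite /norm_trace big_mkcondr big_enum_val /mxtrace; apply: eq_bigr => i _.
rewrite mul_diag_mx mxE [X in X * _]mxE Weil_reprE /diag_coef.
by case: same_norm; rewrite ?mul1r ?mul0r.
Qed.

Lemma Top_charE c s g : s \in T -> g \in U ->
  Top_char h lam_lin T_tr c s g =
    2^-1 * (norm_trace s g + (-1) ^+ c * norm_trace s (iota * g)%g).
Proof.
move=> Ts Ug; rewrite cfunE Ug mulr1n.
rewrite (mxtrace_submod_repr _ Ug (Top_genE c Ts) (Top_proj_idem c s)).
rewrite /Top_proj -scalemxAr -scalemxAl mxtraceZ mulmxDr mulmx1 mulmxDl mxtraceD.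
rewrite -scalemxAr -scalemxAl mxtraceZ -mulmxA -repr_mxM ?iota_unitary //.
by rewrite !trace_orbit_mx.
Qed.

Lemma diag_coef_stab s k : k \in U ->
  diag_coef k s = if k \in stab_yV h s then mu (h (k s) s) else 0.
Proof. by move=> Uk; rewrite stabE Uk. Qed.

(* The matrix entry of a product along v = trep (x^-1 s): the entries of x^-1 and
   of x are inverse to each other. *)
Lemma diag_coefJ s g x : g \in U -> x \in U ->
  diag_coef (g ^ x)%g s = diag_coef g (trep (x^-1%g s)).
Proof.
move=> Ug Ux; have [Tv vE] := trepP (x^-1%g s); set v := trep _ in Tv vE *.
have Uxi := groupVr Ux.
have xv : x v - s \in yV.
  have := unitary_yV Ux (yV_opp vE); rewrite opprB (unitaryB _ _ Ux).
  by rewrite permKV.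
have gxE : ((g ^ x)%g s - s \in yV) = (g v - v \in yV).
  rewrite conjgE !permM; apply/idP/idP=> H.
    have := unitary_yV Uxi (yV_add H (yV_opp xv)); rewrite opprB addrA subrK.
    rewrite (unitaryB _ _ Uxi) !permK => H1.
    have := yV_add (yV_opp (unitary_yV Ug vE)) H1.
    by rewrite (unitaryB _ _ Ug) opprB addrA subrK.
  have H1 := yV_add (unitary_yV Ug vE) H.
  rewrite (unitaryB _ _ Ug) addrA subrK in H1.
  have := yV_add (unitary_yV Ux H1) xv.
  by rewrite (unitaryB _ _ Ux) addrA subrK.
rewrite /diag_coef gxE; case: ifP => // gv.
rewrite conjgE.
have gxv : (g * x)%g v - s \in yV.
  rewrite permM; have := yV_add (unitary_yV Ux gv) xv.
  by rewrite (unitaryB _ _ Ux) addrA subrK.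
rewrite (mu_mul lam_lin Uxi (groupM Ug Ux) vE gxv) (mu_mul lam_lin Ug Ux gv xv).
have := mu_mul lam_lin Uxi Ux vE xv.
rewrite mulVg perm1 (mu_diag h lam_lin) mulrCA => <-.
by rewrite mulr1.
Qed.

(** Any [x0] carrying [s] to [v] modulo [yV] makes the transporter the right coset of C(s) by
    [x0]. *)
Lemma card_transporter s v : s \in T -> v \in T -> same_norm s v ->
  #|[set x in U | trep (x s) == v]| = #|stab_yV h s|.
Proof.
move=> Ts Tv /(same_norm_equiv Ts Tv)[x0 Ux0 x0E].
rewrite -(card_rcoset (stab_yV h s) x0); apply: eq_card => x.
have [_ tx] := trepP (x s).
rewrite mem_rcoset stabE inE; apply/andP/andP=> [[Ux /eqP xv]|[Uxx sE]].
  rewrite xv in tx; rewrite groupM ?groupV // permM; split=> //.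
  have := unitary_yV (groupVr Ux0) (yV_add tx (yV_opp x0E)).
  by rewrite opprB addrA subrK (unitaryB _ _ (groupVr Ux0)) permK.
have Ux : x \in U by rewrite -(groupMr x (groupVr Ux0)).
split=> //; apply/eqP/trep_unique => //.
have := yV_add (unitary_yV Ux0 sE) x0E.
by rewrite (unitaryB _ _ Ux0) addrA subrK permM permKV.
Qed.

(** Conjugation by [x] moves the diagonal entry from [s] to the representative of [x^-1 s]; sorting
    the [x] by this representative meets each vector of the orbit [#|C(s)|] times. *)
Lemma sum_diag_coefJ s g : s \in T -> g \in U ->
  \sum_(x in U) diag_coef (g ^ x)%g s = #|stab_yV h s|%:R * norm_trace s g.
Proof.
move=> Ts Ug.
rewrite (eq_bigr (fun x : {perm V} => diag_coef g (trep (x^-1%g s)))); last first.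
  by move=> x Ux; rewrite diag_coefJ.
rewrite (reindex_inj invg_inj) /=.
rewrite (eq_big (fun x => x \in U) (fun x : {perm V} => diag_coef g (trep (x s)))) /=; first last.
- by move=> x _; rewrite invgK.
- by move=> x; apply: (groupV U).
rewrite (partition_big (fun x : {perm V} => trep (x s))
  (fun v => (v \in T) && same_norm s v)) /=; last first.
  move=> x Ux; have [-> tx] := trepP (x s).
  by rewrite -(same_norm_congr s tx) same_norm_unitary // same_norm_refl.
rewrite mulr_sumr; apply: eq_bigr => v /andP[Tv sv].
rewrite (eq_bigr (fun=> diag_coef g v)) => [|x /andP[_ /eqP->] //].
rewrite -(card_transporter Ts Tv sv) sumr_const mulr_natl; congr (_ *+ _).
by apply: eq_card => x; rewrite inE.
Qed.

(** At most one of the two terms is non-zero: [iota] is not in C(s), so [k] and [iota * k] cannot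
    both belong to C(s). *)
Lemma beta_signE c s k : s \notin yV -> k \in U ->
  beta_sign h lam_lin s c k =
    diag_coef k s + (-1) ^+ c * diag_coef (iota * k)%g s.
Proof.
move=> sy Uk; have iU := iota_unitary h.
rewrite (diag_coef_stab s Uk) (diag_coef_stab s (groupM iU Uk)).
have iC := iota_notin_stab h charF sy.
rewrite cfunE /beta_sign_fun; case: ifP => [Ck|nC].
  rewrite (betaE lam_lin Ck) groupMr // (negPf iC).
  by rewrite mulr0 addr0.
case: ifP => [/Bgroup_dec|]; first by rewrite nC /= add0r => iCk; rewrite iCk betaE.
case: ifP => [iCk|]; last by rewrite mulr0 addr0.
rewrite -[k]mul1g -(iota2 V) -mulgA groupM ?iota_Bgroup //.
exact: (subsetP (stab_sub_Bgroup h s)).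
Qed.

Lemma card_Bgroup s : s \notin yV -> #|Bgroup h s| = (2 * #|stab_yV h s|)%N.
Proof.
move=> sy; have iC := iota_notin_stab h charF sy.
have -> : Bgroup h s = stab_yV h s :|: (iota *: stab_yV h s)%g :> {set {perm V}}.
  apply/setP=> k; rewrite inE mem_lcoset.
  have -> : (iota^-1 = iota)%g by apply/eqP; rewrite eq_invg_mul iota2.
  apply/idP/orP=> [/Bgroup_dec/orP//|[|]]; first exact: (subsetP (stab_sub_Bgroup h s)).
  move=> iCk; rewrite -[k]mul1g -(iota2 V) -mulgA groupM ?iota_Bgroup //.
  exact: (subsetP (stab_sub_Bgroup h s)).
rewrite cardsU card_lcoset addnn -mul2n (_ : _ :&: _ = set0) ?cards0 ?subn0 //.
apply/setP=> k; rewrite in_setI in_set0; apply/negP=> /andP[Ck].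
by rewrite mem_lcoset (groupMr _ (Ck : k \in stab_group h s)) groupV (negPf iC).
Qed.

(** Since [iota] is central, the induction formula splits into sums over the conjugates of [g] and
    of [iota * g], each evaluated by [sum_diag_coefJ]. The index 2 of C(s) in B(s) matches the
    factor 1/2 of the sign projector. *)
Lemma Top_char_Ind c s : s \in T -> s \notin yV ->
  Top_char h lam_lin T_tr c s = 'Ind[U] (beta_sign h lam_lin s c).
Proof.
move=> Ts sy; apply/cfun_inP=> g Ug; rewrite Top_charE // cfIndE ?Bgroup_sub //.
have iU := iota_unitary h.
rewrite (eq_bigr (fun x => diag_coef (g ^ x)%g s
    + (-1) ^+ c * diag_coef ((iota * g) ^ x)%g s)) => [|x Ux].
  rewrite big_split -mulr_sumr /= !sum_diag_coefJ ?groupM // mulrCA -mulrDr mulrA.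
  rewrite (card_Bgroup sy) natrM; congr (_ * _).
  by rewrite invfM -mulrA mulVf ?mulr1 // pnatr_eq0 -lt0n cardG_gt0.
rewrite beta_signE ?groupJ // conjMg [(iota ^ x)%g]conjgE (iota_comm Ux).
by rewrite mulKg.
Qed.

(** * Decomposition of the Weil module over orbit representatives *)

Variable S : {set V}.
Hypothesis S_rep : orbit_representatives h T S.

Local Notation Top_gen := (Top_gen h lam_lin T_tr).
Local Notation Top_char := (Top_char h lam_lin T_tr).
Local Notation S0 := (0 |: S).

Lemma repr_transversal s : s \in S0 -> s \in T.
Proof.
case: S_rep => /subsetP ST _ _; rewrite !inE => /orP[/eqP->|/ST//].
exact: zero_transversal.
Qed.

Lemma repr_notin_yV s : s \in S -> s \notin yV.
Proof. by case: S_rep => _ + _; apply. Qed.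

Lemma repr_neq0 s : s \in S -> s != 0.
Proof. by move/repr_notin_yV; apply: contraNneq => ->; apply: yV_0. Qed.

Lemma repr0_notin : 0 \notin S.
Proof. by apply/negP=> /repr_neq0; rewrite eqxx. Qed.

(** The set [S] omits the class [yV], which 0 represents; with [repr_inj], this makes [0 |: S] a
    system of representatives for all classes. *)
Lemma repr_exists v : exists2 s, s \in S0 & same_norm s v.
Proof.
case: S_rep => _ _ Sv; have [vy|vy] := boolP (v \in yV).
  by exists 0; rewrite ?setU11 // /same_norm vy yV_0 !red_form_yl ?yV_0 ?eqxx.
have [s [[Ss vs] _]] := Sv v vy; exists s; first by rewrite inE Ss orbT.
by rewrite same_norm_sym equiv_same_norm.
Qed.

Lemma repr_inj s s' : s \in S0 -> s' \in S0 -> same_norm s s' -> s = s'.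
Proof.
case: S_rep => _ _ Sv.
move=> S0s S0s' ss'; have Ts := repr_transversal S0s; have Ts' := repr_transversal S0s'.
have /andP[_ /eqP yE] := ss'; move: S0s S0s'; rewrite !inE.
have [sy|sy] := boolP (s \in yV).
  rewrite sy in yE.
  by rewrite (transversal_yV_eq0 Ts sy) (transversal_yV_eq0 Ts' yE).
have s'y : s' \notin yV by rewrite yE.
have nz v : v \notin yV -> (v == 0) = false.
  by move=> vy; apply: contraNF vy => /eqP->; apply: yV_0.
rewrite !nz //= => Ss Ss'; have [t [_ tE]] := Sv s sy.
rewrite -(tE s); last by split=> //; apply: equiv_yV_refl.
by apply: tE; split=> //; apply: same_norm_equiv.
Qed.

Lemma sum_orbit_mx : \sum_(s in S0) orbit_mx s = 1%:M.
Proof.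
apply/matrixP=> i j; rewrite summxE [RHS]mxE.
have [s0 S0s s0i] := repr_exists (enum_val i).
rewrite (bigD1 s0) //= big1 => [|s /andP[S0s' ne]].
  by rewrite addr0 !mxE s0i; case: eqP.
rewrite !mxE; case: (boolP (same_norm s _)) => [si|_]; last by rewrite mul0rn.
case/eqP: ne; apply: repr_inj => //.
by rewrite (same_norm_trans s0 si) same_norm_sym.
Qed.

Lemma Top_orbit_mx0 : Top T *m orbit_mx 0 = 0.
Proof.
apply/sub_kermxP/sumsmx_subP => v /andP[Tv v0]; rewrite genmxE.
apply/sub_kermxP; rewrite weil_basis_orbit_mx // /same_norm yV_0.
rewrite [v \in yV](contraNF _ v0) ?andbF ?scale0r // => vy.
by rewrite (transversal_yV_eq0 Tv vy).
Qed.

Lemma Top_proj_sub_Top c s : s \in S -> (Top_proj c s <= Top T)%MS.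
Proof.
move=> Ss; rewrite /Top_proj orbit_sign_mxC; apply: submx_trans (submxMl _ _) _.
apply/row_subP=> i; rewrite -weil_basis_mul weil_basis_orbit_mx ?enum_valP //.
case: (boolP (same_norm _ _)) => [si|_]; last by rewrite scale0r sub0mx.
rewrite scale1r (sumsmx_sup (enum_val i)) ?genmxE // enum_valP /=.
have /andP[_ /eqP yE] := si; apply: contraNneq (repr_notin_yV Ss) => i0.
by rewrite -yE i0 yV_0.
Qed.

Lemma sum_Top_gen c :
  (\sum_(s in S) Top_gen c s :=: Top_sign h lam_lin T_tr c)%MS.
Proof.
apply/eqmxP/andP; split.
  apply/sumsmx_subP => s Ss; rewrite Top_genE ?repr_transversal ?inE ?Ss ?orbT //.
  rewrite sub_capmx Top_proj_sub_Top //=; apply/eigenspaceP.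
  by rewrite -mulmxA iota_sign_mx -scalemxAr.
set W := Top_sign _ _ _ c.
have WJ : W *m sign_mx c = W by apply/sign_mx_id/eigenspaceP/capmxSr.
have W0 : W *m orbit_mx 0 = 0.
  have /submxP[D ->] : (W <= Top T)%MS by apply: capmxSl.
  by rewrite -mulmxA Top_orbit_mx0 mulmx0.
(* The orbit projectors resolve the identity, and the one at 0 vanishes on [W]; what remains splits
   [W] into its components in the summands. *)
rewrite -[W]mulmx1 -sum_orbit_mx mulmx_sumr big_setU1 ?repr0_notin //= W0 add0r.
apply: summx_sub_sums => s Ss; rewrite Top_genE ?repr_transversal ?inE ?Ss ?orbT //.
by rewrite -WJ -mulmxA -orbit_sign_mxC submxMl.
Qed.

(** The projector of [s] fixes its own summand and annihilates all the others. *)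
Lemma direct_sum_Top_gen c : mxdirect (\sum_(s in S) Top_gen c s)%MS.
Proof.
apply/mxdirect_sumsP => s Ss; set W := (_ :&: _)%MS.
have S0S t : t \in S -> t \in S0 by rewrite inE orbC => ->.
have WP : W *m Top_proj c s = W.
  by apply: mx_Top_projP; rewrite -Top_genE ?capmxSl // repr_transversal ?S0S.
rewrite -WP; apply/sub_kermxP; apply: submx_trans (capmxSr _ _) _.
apply/sumsmx_subP => t /andP[St ts]; rewrite Top_genE ?repr_transversal ?S0S //.
apply/sub_kermxP; rewrite Top_projM; case: ifP => // /repr_inj e.
by rewrite e ?eqxx ?S0S in ts.
Qed.

(** The pair [(false, 0)] stands for the line of [e_0], which gives the trivial character;
    [(true, 0)] is left out because its generator is zero. *)
Definition constt_index : {set bool * V} :=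
  (false, 0) |: [set p : bool * V | p.2 \in S].

Lemma card_constt_index : #|constt_index| = (2 * #|S| + 1)%N.
Proof.
rewrite cardsU1 inE (negPf repr0_notin) /= addnC; congr (_ + _)%N.
have -> : [set p : bool * V | p.2 \in S] = setX [set: bool] S.
  by apply/setP=> p; rewrite !inE.
by rewrite cardsX cardsT card_bool.
Qed.

Lemma constt_indexP p : p \in constt_index ->
  p.2 \in S0 /\ ((p.2 == 0) ==> ~~ p.1).
Proof.
rewrite !inE => /orP[/eqP->|Sp]; first by rewrite eqxx.
by rewrite Sp orbT (negPf (repr_neq0 Sp)).
Qed.

Lemma Top_char_irr p : p \in constt_index -> Top_char p.1 p.2 \in irr U.
Proof.
case/constt_indexP=> S0p p0; apply/irr_reprP.
pose modT := cyclic_mx_module rho (signed_vec p.1 p.2).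
exists (Representation (submod_repr modT)) => //.
exact/submod_mx_irr/(Top_gen_simple (repr_transversal S0p) p0).
Qed.

Lemma Top_char_inj :
  {in constt_index &, injective (fun p => Top_char p.1 p.2)}.
Proof.
move=> [c s] [c' s'] /constt_indexP[/= S0s sc] /constt_indexP[/= S0s' _].
move=> /(@cfRepr_inj _ U _ _ _ _)/mx_rsim_iso iso.
have [-> ss'] := Top_gen_iso (repr_transversal S0s) (repr_transversal S0s') sc iso.
by rewrite (repr_inj S0s' S0s ss').
Qed.

Lemma norm_trace0 g : g \in U -> norm_trace 0 g = 1.
Proof.
move=> Ug; rewrite /norm_trace (big_pred1 0) => [|v].
  have g0 : g 0 = 0 by rewrite -(subrr 0) (unitaryB _ _ Ug) !subrr.
  by rewrite /diag_coef g0 subrr yV_0 mu_diag.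
apply/andP/eqP=> [[Tv /andP[_ /eqP]]|->]; last by rewrite zero_transversal same_norm_refl.
by rewrite yV_0 => /(transversal_yV_eq0 Tv).
Qed.

Lemma Top_char0 : Top_char false 0 = 1.
Proof.
apply/cfun_inP=> g Ug; rewrite cfun1E Ug Top_charE ?zero_transversal //.
rewrite !norm_trace0 ?groupM ?iota_unitary // mulr1 -(natrD _ 1 1) mulVf //.
by rewrite pnatr_eq0.
Qed.

Lemma Top_char_pair s g : s \in T -> g \in U ->
  Top_char true s g + Top_char false s g = norm_trace s g.
Proof.
move=> Ts Ug; rewrite !Top_charE // -mulrDr addrACA -mulrDl /=.
rewrite addNr mul0r addr0; set x := norm_trace s g.
have -> : x + x = 2 * x by rewrite mulr_natl mulr2n.
by rewrite mulrA mulVf ?mul1r // pnatr_eq0.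
Qed.

(** The resolution of the identity splits the trace into orbit traces. On an orbit in [S] the two
    signs add up to the orbit trace, as their [iota] terms cancel. *)
Lemma Weil_char_sum : cfRepr rho = \sum_(p in constt_index) Top_char p.1 p.2.
Proof.
apply/cfun_inP=> g Ug; rewrite cfunE Ug mulr1n sum_cfunE.
have T0 : Top_char false 0 g = 1 by rewrite Top_char0 cfun1E Ug.
rewrite -[rho g]mul1mx -sum_orbit_mx mulmx_suml raddf_sum /=.
rewrite big_setU1 ?repr0_notin //= big_setU1 ?inE ?repr0_notin //=.
rewrite trace_orbit_mx norm_trace0 // T0; congr (_ + _).
rewrite (eq_bigl (fun p : bool * V => predT p.1 && (p.2 \in S))); last first.
  by move=> p; rewrite inE.
rewrite -(pair_big predT [in S] (fun c s => Top_char c s g)) /= big_bool /=.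
rewrite -big_split /=; apply: eq_bigr => s Ss; rewrite trace_orbit_mx.
by rewrite Top_char_pair // repr_transversal // inE Ss orbT.
Qed.

(** The summands are irreducible with pairwise distinct characters, so every multiplicity is 0 or 1;
    the list of constituents and their number also follow. *)
Lemma Weil_char_dot (i : Iirr U) : '[cfRepr rho, 'chi_i] =
  (i \in [set cfIirr (Top_char p.1 p.2) | p in constt_index])%:R.
Proof.
rewrite Weil_char_sum cfdot_suml.
rewrite (eq_bigr (fun p => (cfIirr (Top_char p.1 p.2) == i)%:R)); last first.
  by move=> p Jp; rewrite -[in LHS](cfIirrE (Top_char_irr Jp)) cfdot_irr.
have [/imsetP[p Jp ->]|ni] := boolP (i \in _).
  rewrite (bigD1 p) //= eqxx big1 ?addr0 // => p' /andP[Jp' ne].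
  case: eqP => // e; case/eqP: ne; apply: Top_char_inj => //=.
  by rewrite -(cfIirrE (Top_char_irr Jp)) -(cfIirrE (Top_char_irr Jp')) e.
by rewrite big1 // => p Jp; case: eqP => // e; rewrite -e imset_f in ni.
Qed.

Lemma Weil_constt : irr_constt (cfRepr rho)
  =i [set cfIirr (Top_char p.1 p.2) | p in constt_index].
Proof.
by move=> i; rewrite irr_consttE Weil_char_dot pnatr_eq0 eqb0 negbK.
Qed.

Lemma Weil_multiplicity_free (i : Iirr U) :
  i \in irr_constt (cfRepr rho) -> '[cfRepr rho, 'chi_i] = 1.
Proof. by rewrite Weil_char_dot Weil_constt => ->. Qed.

Lemma card_Weil_constt : #|irr_constt (cfRepr rho)| = (2 * #|S| + 1)%N.
Proof.
rewrite (eq_card Weil_constt) card_in_imset ?card_constt_index // => p p' Jp Jp' e.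
apply: Top_char_inj => //=.
by rewrite -(cfIirrE (Top_char_irr Jp)) -(cfIirrE (Top_char_irr Jp')) e.
Qed.

Lemma Weil_consttP (i : Iirr U) : i \in irr_constt (cfRepr rho) <->
  'chi_i = 1 \/ exists c s, s \in S /\ 'chi_i = Top_char c s.
Proof.
rewrite Weil_constt; split=> [/imsetP[p Jp ->]|].
  rewrite (cfIirrE (Top_char_irr Jp)); move: Jp.
  rewrite !inE => /orP[/eqP->|Sp]; first by left; rewrite Top_char0.
  by right; exists p.1, p.2.
have mem p : p \in constt_index -> 'chi_i = Top_char p.1 p.2 ->
    i \in [set cfIirr (Top_char p.1 p.2) | p in constt_index].
  move=> Jp e; apply/imsetP; exists p => //; apply: irr_inj.
  by rewrite (cfIirrE (Top_char_irr Jp)).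
case=> [e|[c [s [Ss e]]]]; [apply: (mem (false, 0))|apply: (mem (c, s))].
- exact: setU11.
- by rewrite Top_char0.
- by rewrite !inE Ss orbT.
- by [].
Qed.

End WeilModule.

(** * Values of the quadratic form *)

Section NormValues.

Variables (F : finFieldType) (V : finLmodType (dualnum F)).
Hypothesis charF : 2%N \notin [pchar F].
Variable m : nat.
Hypothesis V_free : free_of_rank V m.
Variable h : hermitian_form V.
Hypothesis h_nondeg : nondegenerate_form h.

Local Notation y := ('qX : dualnum F).
Local Notation yV := (yV V).
Local Notation b := (red_form h).
Implicit Types (a : dualnum F) (u v w : V) (e : nat -> V).

(** Indexing by [nat] lets a family grow without casts between ordinals. Orthogonality is asked of
    [h] itself, not only modulo [y], so that full families diagonalize [h]. *)
Definition orthogonal_family k e :=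
  (forall i, (i < k)%N -> b (e i) (e i) != 0)
  /\ (forall i j, (i < k)%N -> (j < k)%N -> i != j -> h (e i) (e j) = 0).

Lemma form_sumr u k (f : 'I_k -> V) : h u (\sum_i f i) = \sum_i h u (f i).
Proof. exact: (big_morph (h u) (formDr h u) (form0r h u)). Qed.

Lemma orthogonal_form_sum k e (c : 'I_k -> dualnum F) (j : 'I_k) :
  orthogonal_family k e -> h (e j) (\sum_(i < k) c i *: e i) = c j * (b (e j) (e j))%:A.
Proof.
case=> _ e_orth; rewrite form_sumr (bigD1 j) //= big1 ?addr0 => [|i ij].
  by rewrite formZr form_diagE.
by rewrite formZr e_orth ?mulr0 // eq_sym.
Qed.

(** Gram-Schmidt; the denominators [b (e i) (e i)] are the values [h (e i) (e i)], by
    [form_diagE]. *)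
Definition ortho_proj k e u :=
  u - \sum_(i < k) (h (e i) u * ((b (e i) (e i))^-1)%:A) *: e i.

Lemma ortho_projP k e u j : orthogonal_family k e -> (j < k)%N ->
  h (e j) (ortho_proj k e u) = 0.
Proof.
move=> e_orth jk; rewrite formBr (orthogonal_form_sum _ (Ordinal jk) e_orth) /=.
by rewrite -mulrA dualA_unit ?mulr1 ?subrr // e_orth.1.
Qed.

Lemma card_free_module : #|V| = (#|F| ^ (2 * m))%N.
Proof.
have [e e_bij] := V_free; rewrite -(bij_eq_card e_bij) card_mx mul1n.
by rewrite card_dualnum expnM.
Qed.

Lemma card_F_gt1 : (1 < #|F|)%N.
Proof.
have := subset_leq_card (subsetT [set 0; 1 : F]).
by rewrite cards2 eq_sym oner_eq0 cardsT.
Qed.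

Lemma ortho_complement_notin_yV k e : (k < m)%N -> orthogonal_family k e ->
  exists2 w, w \notin yV & forall j, (j < k)%N -> h (e j) w = 0.
Proof.
move=> km e_orth.
pose phi u : 'rV[dualnum F]_k := \row_i h (e i) u.
(* Counting: [V] has [q ^ (2 * m)] elements, more than the [q ^ (2 * k)] rows available as
   values. *)
have /injectivePn[u [u' ne uu']] : ~~ injectiveb phi.
  apply/injectiveP => /leq_card; rewrite card_mx mul1n card_dualnum card_free_module.
  by rewrite -expnM leqNgt ltn_exp2l ?ltn_pmul2l ?card_F_gt1 // km.
have dE j : (j < k)%N -> h (e j) (u - u') = 0.
  move=> jk; have /rowP/(_ (Ordinal jk)) := uu'; rewrite !mxE /= => ejE.
  by rewrite formBr ejE subrr.
have [/yVP[w wE]|dy] := boolP (u - u' \in yV); last by exists (u - u').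
have wy : w \notin yV.
  apply: contraNN ne => /yVP[w' w'E]; rewrite -subr_eq0 wE w'E scalerA qX_sqr.
  by rewrite scale0r.
(* When the orthogonal vector found is [y *: w], the vector [w] is orthogonal to the family only
   modulo [y]; the projection then corrects it by an element of [yV]. *)
exists (ortho_proj k e w); last by move=> j jk; rewrite ortho_projP.
apply: contraNN wy => py; rewrite -[w](subrK (ortho_proj k e w)) yV_add //.
rewrite opprB addrC subrK.
apply: (big_ind (fun v => v \in yV)) => [||i _]; [exact: yV_0|exact: yV_add|].
apply: yV_scale0; rewrite coef_dualM0.
have := dE i (ltn_ord i); rewrite wE formZr qX_mul.
move/(congr1 (fun c : dualnum F => c`_1)); rewrite coef_dualZ coef_qX mulr1 coef0.
by move=> ->; rewrite mul0r.
Qed.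

Lemma form_eq0C u v : h u v = 0 -> h v u = 0.
Proof.
by move=> uv; rewrite formC uv; apply: dualP; rewrite ?dconj0 ?dconj1 !coef0 ?oppr0.
Qed.

(** If the vector [w] found in the complement is isotropic, a partner [u] is projected into the
    complement, which keeps [b w u] since [w] is orthogonal to the family. Then [u'] or [w + u'] is
    anisotropic. *)
Lemma orthogonal_extension k e : (k < m)%N -> orthogonal_family k e ->
  exists2 w, b w w != 0 & forall j, (j < k)%N -> h (e j) w = 0.
Proof.
move=> km e_orth; have [w wy wE] := ortho_complement_notin_yV km e_orth.
have [w0|] := eqVneq (b w w) 0; last by exists w.
have [u uw] := red_form_nondeg V_free h_nondeg wy.
pose u' := ortho_proj k e u.
have u'E j : (j < k)%N -> h (e j) u' = 0 by move=> jk; rewrite ortho_projP.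
have u'w : b w u' != 0.
  rewrite /red_form /u' /ortho_proj formBr form_sumr big1 => [|i _].
    by rewrite subr0 -/(red_form h w u) red_formC.
  by rewrite formZr (form_eq0C (wE i _)) ?mulr0.
clearbody u'; have [u0|] := eqVneq (b u' u') 0; last by exists u'.
exists (w + u') => [|j jk]; last by rewrite formDr wE // u'E // addr0.
rewrite !(red_formDl, red_formDr) w0 u0 addr0 add0r (red_formC h u').
by rewrite -mulr2n -mulr_natl mulf_neq0 // two_neq0.
Qed.

Lemma orthogonal_family_extend k e w : orthogonal_family k e -> b w w != 0 ->
    (forall j, (j < k)%N -> h (e j) w = 0) ->
  orthogonal_family k.+1 (fun i => if i == k then w else e i).
Proof.
move=> [e0 eo] w0 we.
have lt i : (i < k.+1)%N -> i != k -> (i < k)%N.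
  by rewrite ltnS leq_eqVlt => /orP[/eqP->|//]; rewrite eqxx.
split=> [i ik|i j ik jk]; first by have [_|ne] := eqVneq i k; rewrite // e0 // lt.
have [iE|ik'] := eqVneq i k; have [jE|jk'] := eqVneq j k.
- by rewrite iE jE eqxx.
- by move=> _; apply/form_eq0C/we/lt.
- by move=> _; apply/we/lt.
by apply: eo; apply: lt.
Qed.

Lemma orthogonal_family_exists k : (k <= m)%N -> exists e, orthogonal_family k e.
Proof.
elim: k => [_|k IHk km]; first by exists (fun=> 0); split=> // i.
have [e e_orth] := IHk (ltnW km).
have [w w0 we] := orthogonal_extension km e_orth.
by eexists; apply: orthogonal_family_extend e_orth w0 we.
Qed.

(** Pairing with [e j] recovers the coordinates, so the coordinate map is injective; equality of
    cardinals makes it bijective. *)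
Lemma orthogonal_is_basis e : orthogonal_family m e ->
  is_basis (fun i : 'I_m => e i).
Proof.
move=> e_orth; apply: inj_card_bij; last first.
  by rewrite card_free_module card_mx mul1n card_dualnum expnM.
move=> c c' /= cc'; apply/rowP=> j.
have := congr1 (h (e j)) cc'; rewrite !(orthogonal_form_sum _ j e_orth).
move/(congr1 ( *%R^~ ((b (e j) (e j))^-1)%:A)); rewrite -!mulrA.
rewrite [(_)%:A * _]mulrC dualA_unit ?mulr1 //.
exact: e_orth.1.
Qed.

(** * Number of values of the form outside yV *)

Definition norm_values : {set F} := [set b v v | v in ~: yV].

Lemma norm_valuesP (r : F) :
  reflect (exists2 v, v \notin yV & b v v = r) (r \in norm_values).
Proof.
apply: (iffP imsetP) => [[v vy ->]|[v vy <-]]; exists v => //.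
  by rewrite in_setC in vy.
by rewrite in_setC.
Qed.

(** The norm is constant on orbits and, by transitivity, separates those outside [yV]. *)
Lemma card_orbit_representatives T S : orbit_representatives h T S ->
  #|S| = #|norm_values|.
Proof.
case=> _ Sy Sv; have -> : norm_values = [set b s s | s in S].
  apply/setP=> r; apply/norm_valuesP/imsetP=> [[v vy <-]|[s Ss ->]].
    have [s [[Ss vs] _]] := Sv v vy; exists s => //; exact: equiv_yV_red_form.
  by exists s; rewrite ?Sy.
rewrite card_in_imset // => s s' Ss Ss' ss'.
have [t [_ tE]] := Sv s (Sy s Ss).
rewrite -(tE s); last by split=> //; apply: equiv_yV_refl.
apply: tE; split=> //.
by apply: (equiv_yV_of_red_form charF V_free h_nondeg); rewrite ?Sy.
Qed.

Lemma red_form_comb2 u v (p q : dualnum F) : b u v = 0 ->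
  b (p *: u + q *: v) (p *: u + q *: v) =
    b u u * p`_0 ^+ 2 + b v v * q`_0 ^+ 2.
Proof.
move=> uv; rewrite !(red_formDl, red_formDr, red_formZl, red_formZr).
by rewrite (red_formC h v) uv; ring.
Qed.

Lemma binary_norm_universal u v (r : F) :
    b u u != 0 -> b v v != 0 -> b u v = 0 ->
  exists p q : F, b (p%:A *: u + q%:A *: v) (p%:A *: u + q%:A *: v) = r.
Proof.
move=> u0 v0 uv; have [p [q E]] := binary_form_universal charF r u0 v0.
by exists p, q; rewrite red_form_comb2 // !coef_dualA.
Qed.

Lemma orthogonal_red_form k e i j : orthogonal_family k e -> (i < k)%N ->
  (j < k)%N -> i != j -> b (e i) (e j) = 0.
Proof. by case=> _ eo ik jk ij; rewrite /red_form eo ?coef0. Qed.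

Lemma norm_values_nonzero (r : F) : (1 < m)%N -> r != 0 -> r \in norm_values.
Proof.
move=> m1 r0; have [e e_orth] := orthogonal_family_exists m1.
have [p [q E]] := binary_norm_universal r (e_orth.1 0%N isT) (e_orth.1 1%N isT)
  (orthogonal_red_form e_orth (isT : (0 < 2)%N) (isT : (1 < 2)%N) isT).
apply/norm_valuesP; eexists; last exact: E.
by apply: contraNN r0 => vy; rewrite -E red_form_yl.
Qed.

Lemma norm_values_full : (1 < m)%N -> 0 \in norm_values -> #|norm_values| = #|F|.
Proof.
move=> m1 v0; rewrite -cardsT; apply: eq_card => r; rewrite inE.
by have [->|r0] := eqVneq r 0; last exact: norm_values_nonzero.
Qed.

Lemma norm_values_0_gt2 : (2 < m)%N -> 0 \in norm_values.
Proof.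
move=> m2; have [e e_orth] := orthogonal_family_exists m2.
have eo i j := @orthogonal_red_form 3 e i j e_orth.
(* The first two vectors represent minus the norm of the third, so adding the third gives an
   isotropic vector; it pairs non-trivially with [e 2], hence is not in [yV]. *)
have [p [q E]] := binary_norm_universal (- b (e 2%N) (e 2%N))
  (e_orth.1 0%N isT) (e_orth.1 1%N isT) (eo 0%N 1%N isT isT isT).
set v := _ + _ in E; have v2 : b v (e 2%N) = 0.
  by rewrite red_formDl !red_formZl !eo // !mulr0 addr0.
clearbody v; apply/norm_valuesP; exists (v + e 2%N).
  apply: contraNN (e_orth.1 2%N isT) => /(red_form_yl h (e 2%N)).
  by rewrite red_formDl v2 add0r => ->.
by rewrite !(red_formDl, red_formDr) E v2 (red_formC h _ v) v2 add0r addr0 addNr.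
Qed.

Lemma of_type2P (r1 r2 : F) : of_type h [:: r1; r2] ->
  exists u v, [/\ b u u = r1, b v v = r2, b u v = 0 &
    forall w, exists p q : dualnum F, w = p *: u + q *: v].
Proof.
case=> e [f fK eK] /matrixP G.
have e0 := G 0 0; have e1 := G 1 1; have e01 := G 0 1; rewrite !mxE in e0 e1 e01.
exists (e 0), (e 1); split; rewrite /red_form.
- by rewrite e0 /= coef_dualA.
- by rewrite e1 /= coef_dualA.
- by rewrite e01 /= coef0.
move=> w; exists (f w 0 0), (f w 0 1); rewrite -{1}[w]eK.
by rewrite big_ord_recl big_ord1; congr (_ + f w 0 _ *: e _); apply: val_inj.
Qed.

Lemma norm_values_split : of_type h [:: 1; -1] -> 0 \in norm_values.
Proof.
case/of_type2P=> u [v [u1 v1 uv _]]; apply/norm_valuesP; exists (u + v); last first.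
  by rewrite !(red_formDl, red_formDr) u1 v1 (red_formC h v) uv addr0 add0r subrr.
apply/negP=> /(red_form_yl h u)/eqP.
by rewrite red_formDl u1 (red_formC h v) uv addr0 oner_eq0.
Qed.

Lemma norm_values_anisotropic (delta : F) : (forall x, x ^+ 2 != delta) ->
  (1 < m)%N -> of_type h [:: 1; - delta] -> #|norm_values| = #|F|.-1.
Proof.
move=> nsq m1 /of_type2P[u [v [u1 v1 uv uvE]]].
rewrite -(cardsC1 (0 : F)); apply: eq_card => r; rewrite !inE.
apply/idP/idP => [|r0]; last exact: norm_values_nonzero.
case/norm_valuesP=> w wy <-; apply: contraNN wy.
have [p [q ->]] := uvE w; rewrite red_form_comb2 // u1 v1 mul1r mulNr subr_eq0.
(* An isotropic vector satisfies [p_0^2 = delta * q_0^2]; since [delta] is a non-square both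
   constant coefficients vanish, which puts the vector in [yV]. *)
have [q0|q0] := eqVneq (q`_0) 0; last first.
  move=> /eqP E; have /eqP[] := nsq (p`_0 / q`_0).
  by rewrite exprMn E exprVn mulfK // expf_neq0.
rewrite q0 expr0n mulr0 expf_eq0 /= => /eqP p0.
by rewrite yV_add ?yV_scale0.
Qed.

(** The norm of [p *: e 0] is [b (e 0) (e 0)] times the square of the constant coefficient of [p],
    so the values form one coset of the non-zero squares. *)
Lemma norm_values_rank1 : m = 1%N -> #|norm_values| = (#|F|.-1)./2.
Proof.
move=> m1; have [e e_orth] := orthogonal_family_exists (leqnn m).
have [f fK eK] := orthogonal_is_basis e_orth.
have e0 : b (e 0%N) (e 0%N) != 0 by apply: e_orth.1; rewrite m1.
have ey : e 0%N \notin yV by apply: contraNN e0 => ey; rewrite red_form_yl.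
have eE w : exists p : dualnum F, w = p *: e 0%N.
  rewrite -[w]eK; move: (f w) => c; clear -m1; case: m / (esym m1) c => c.
  by exists (c 0 0); rewrite big_ord1.
have -> : norm_values = [set b (e 0%N) (e 0%N) * x | x in nonzero_squares F].
  apply/setP=> r; apply/norm_valuesP/imsetP=> [[w wy <-]|[_ /imsetP[x x0 ->] ->]].
    have [p wE] := eE w; exists (p`_0 ^+ 2).
      apply: imset_f; rewrite !inE; apply: contraNN wy => /eqP p0.
      by rewrite wE yV_scale0.
    by rewrite wE red_formZl red_formZr; ring.
  rewrite !inE in x0; exists (x%:A *: e 0%N).
    by rewrite yV_scale_unit // coef_dualA.
  by rewrite red_formZl red_formZr !coef_dualA mulr1n; ring.
rewrite card_imset; last exact: mulfI.
by rewrite -(card_nonzero_squares charF) mul2n doubleK.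
Qed.

(** A vector of norm 1 exists by universality; a vector orthogonal to it is rescaled to norm [-1] or
    [- delta], according to the square class of minus its norm. *)
Lemma of_type_rank2 (delta : F) : (forall x, x ^+ 2 != delta) -> m = 2%N ->
  of_type h [:: 1; -1] \/ of_type h [:: 1; - delta].
Proof.
move=> nsq m2; have [e e_orth] : exists e, orthogonal_family 2 e.
  by apply: orthogonal_family_exists; rewrite m2.
have [p [q E]] := binary_norm_universal 1 (e_orth.1 0%N isT) (e_orth.1 1%N isT)
  (orthogonal_red_form e_orth (isT : (0 < 2)%N) (isT : (1 < 2)%N) isT).
set u := _ + _ in E.
have u_orth : orthogonal_family 1 (fun=> u).
  by split=> [i _|[|i] [|j]] //; rewrite E oner_neq0.
have [|w w0 wu] := @orthogonal_extension 1 (fun=> u) _ u_orth; first by rewrite m2.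
suff type_of t (r : F) : t != 0 -> r != 0 -> - b w w = r * t ^+ 2 -> of_type h [:: 1; - r].
  have d0 : delta != 0 by have := nsq 0; rewrite expr0n eq_sym.
  have bw0 : - b w w != 0 by rewrite oppr_eq0.
  have [t t0 [tE|tE]] := nonsquare_cosets charF nsq bw0.
    by left; apply: (type_of t); rewrite ?oner_neq0 // mul1r.
  by right; apply: (type_of t).
move=> t0 r0 tE; pose w' := (t^-1)%:A *: w.
have w'E : b w' w' = - r.
  rewrite red_formZl red_formZr !coef_dualA mulr1n -[b w w]opprK tE.
  by field.
pose f i := if i == 1%N then w' else u.
have f_orth : orthogonal_family m f.
  rewrite m2; apply: (orthogonal_family_extend u_orth); rewrite ?w'E ?oppr_eq0 //.
  by move=> j j1; rewrite formZr (wu j) // mulr0.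
have f_basis := orthogonal_is_basis f_orth; rewrite m2 in f_basis.
exists (fun i : 'I_2 => f i) => //.
have uw' : h u w' = 0 by rewrite formZr (wu 0%N) // mulr0.
apply/matrixP=> [[[|[|i]] //= i2] [[|[|j]] //= j2]]; rewrite !mxE /f /=.
- by rewrite form_diagE // E.
- by rewrite uw'.
- by rewrite form_eq0C.
by rewrite form_diagE // w'E.
Qed.

End NormValues.

Theorem theorem11p1 (F : finFieldType) (charF : 2%N \notin [pchar F])
    (V : finLmodType (dualnum F)) (m : nat) (m_gt0 : (0 < m)%N)
    (V_free : free_of_rank V m)
    (h : hermitian_form V) (h_nondeg : nondegenerate_form h)
    (lam : 'CF([set: F])) (lam_lin : lam \is a linear_char) (lam_neq1 : lam != 1)
    (T : {set V}) (T_tr : symmetric_transversal T)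
    (S : {set V}) (S_rep : orbit_representatives h T S)
    (delta : F) (delta_nsq : forall x : F, x ^+ 2 != delta) :
  let X := cfRepr (Weil_repr h lam_lin T_tr) in
  let Top_s := Top_gen h lam_lin T_tr in
  [/\ forall b : bool,
        (\sum_(s in S) Top_s b s :=: Top_sign h lam_lin T_tr b)%MS
        /\ mxdirect (\sum_(s in S) Top_s b s)%MS,
      forall (b : bool) (s : V), s \in S ->
        mxsimple (Weil_repr h lam_lin T_tr) (Top_s b s)
        /\ Top_char h lam_lin T_tr b s
           = 'Ind[unitary h] (beta_sign h lam_lin s b)
    & [/\ forall i, i \in irr_constt X -> '[X, 'chi_i] = 1,
          forall i, i \in irr_constt X <->
            'chi_i = 1 \/ exists (b : bool) (s : V),
              s \in S /\ 'chi_i = Top_char h lam_lin T_tr b s,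
          exists K, constituent_number h m delta K
        & forall K, constituent_number h m delta K ->
            #|S| = K /\ #|irr_constt X| = (2 * K + 1)%N]].
Proof.
move=> X Top_s; have SE := card_orbit_representatives charF V_free h_nondeg S_rep.
split.
- move=> c; split; first exact: (sum_Top_gen charF V_free h_nondeg lam_lin T_tr S_rep).
  exact: (direct_sum_Top_gen charF V_free h_nondeg lam_lin T_tr S_rep).
- move=> c s Ss; have Ts : s \in T.
    by apply: (repr_transversal charF T_tr S_rep); rewrite inE Ss orbT.
  have sy := repr_notin_yV S_rep Ss; split.
    apply: (Top_gen_simple charF V_free h_nondeg lam_lin lam_neq1 T_tr Ts).
    by rewrite (negPf (repr_neq0 S_rep Ss)).
  exact: (Top_char_Ind charF V_free h_nondeg).
split.
- exact: (Weil_multiplicity_free charF V_free h_nondeg lam_neq1 S_rep).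
- exact: (Weil_consttP charF V_free h_nondeg lam_lin lam_neq1 T_tr S_rep).
(* Only rank two depends on the type of [h], and there the two listed types are exhaustive. *)
- have [m2|m2] := ltnP 2 m; first by exists #|F|; apply: Or31; split; [left|].
  case: m m_gt0 V_free m2 => [|[|[|]]] // _ V_free' _.
    by exists (#|F|.-1)./2; apply: Or33.
  have [t|t] := of_type_rank2 charF V_free' h_nondeg delta_nsq erefl.
    by exists #|F|; apply: Or31; split; [right|].
  by exists #|F|.-1; apply: Or32.
move=> K KE; have SK : #|S| = K.
  rewrite SE; case: KE => [[[m2|[m2 t]] ->]|[[m2 t] ->]|[m1 ->]].
  - apply: (norm_values_full charF V_free h_nondeg (ltnW m2)).
    exact: (norm_values_0_gt2 charF V_free h_nondeg m2).
  - apply: (norm_values_full charF V_free h_nondeg); first by rewrite m2.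
    exact: norm_values_split t.
  - by apply: (norm_values_anisotropic charF V_free h_nondeg delta_nsq _ t); rewrite m2.
  exact: (norm_values_rank1 charF V_free h_nondeg m1).
split=> //; rewrite -SK.
exact: (card_Weil_constt charF V_free h_nondeg lam_lin lam_neq1 T_tr S_rep).
Qed.
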